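(* Let $p$ be an odd prime and let $G$ be the GGS-group with defining vector $\mathbf{e}=(1,\ldots,1,\lambda)\in\mathbb{F}_p^{p-1}$, where $\lambda\in\mathbb{F}_p$ and $\lambda\ne 1,2$. Then the derived subgroup $G'$ is an infinite, finitely generated, residually finite, and torsion-free group whose profinite completion is a pro-$p$ group.
   Context: Fix an odd prime $p$. Let $X=\{1,\dots,p\}$ and let $T$ be the regular rooted tree whose vertices are the words in the free monoid $X^*$, with $u,v$ joined by an edge if $v=ux$ or $u=vx$ for some $x\in X$. $\operatorname{Aut} T$ is the group of automorphisms of $T$ and $\operatorname{st}(1)$ is the stabilizer of all vertices of length $1$. For $g$ fixing a vertex $v$, $g_v\in\operatorname{Aut}T$ denotes the restriction of $g$ to the subtree rooted at $v$ (identified with $T$), i.e. $g(vw)=v\,g_v(w)$; $\psi:\operatorname{st}(1)\to \operatorname{Aut}T\times\overset{p}{\cdots}\times\operatorname{Aut}T$ is the isomorphism $g\mapsto(g_1,\dots,g_p)$. For a non-zero vector $\mathbf{e}=(e_1,\dots,e_{p-1})\in\mathbb{F}_p^{p-1}$, the GGS-group with defining vector $\mathbf{e}$ is $G=\langle a,b\rangle\le\operatorname{Aut}T$, where $a$ is the rooted automorphism given by $a(xv)=\sigma(x)v$ for $x\in X$, $v\in X^*$, with $\sigma=(1\;2\;\dots\;p)$, and $b\in\operatorname{st}(1)$ is recursively defined by $\psi(b)=(a^{e_1},a^{e_2},\dots,a^{e_{p-1}},b)$. *)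

(* Defs.v *)
From HB Require Import structures.
From mathcomp Require Import all_boot all_order all_algebra generic_quotient.
From mathcomp Require Import all_classical topology.

Set Implicit Arguments.
Unset Strict Implicit.
Unset Printing Implicit Defensive.

Local Open Scope classical_set_scope.
Local Open Scope quotient_scope.
Local Open Scope group_scope.

Record subgroup (G : groupType) := Subgroup {
  subgroup_set :> set G;
  subgroup_closed : group_closed (mem subgroup_set)
}.

Definition subgroup_type (G : groupType) (H : subgroup G) : Type :=
  set_type H.

HB.instance Definition _ (G : groupType) (H : subgroup G) :=
  SubChoice.on (subgroup_type H).
HB.instance Definition _ (G : groupType) (H : subgroup G) :=
  SubChoice_isSubGroup.Build G (fun x => x \in (H : set G)) (subgroup_type H)
    (subgroup_closed H).

Section Subgroups.
Variable G : groupType.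
Implicit Types (H : subgroup G) (S : set G) (x y : G).

Lemma smallest_group_closed S :
  group_closed (mem (smallest [set A : set G | group_closed (mem A)] S)).
Proof.
split; first by apply/mem_set => A [[A1 _] _]; exact: set_mem.
move=> x y /set_mem xS /set_mem yS; apply/mem_set => A [[A1 AF] SA].
have xA : x \in A by apply/mem_set; apply: xS; split.
have yA : y \in A by apply/mem_set; apply: yS; split.
by apply: set_mem; apply: AF.
Qed.

Definition generated S : subgroup G := Subgroup (smallest_group_closed S).

Definition derived_subgroup : subgroup G :=
  generated [set z | exists x y, z = [~ x, y]].

Section LeftCosets.
Variable H : subgroup G.

Lemma subgroup1 : 1 \in (H : set G).
Proof. by case: (subgroup_closed H). Qed.

Lemma subgroupF x y : x \in (H : set G) -> y \in (H : set G) ->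
  x / y \in (H : set G).
Proof. by case: (subgroup_closed H) => _; apply. Qed.

Lemma subgroupV x : x \in (H : set G) -> x^-1 \in (H : set G).
Proof. by move=> Hx; rewrite -[_^-1]mul1g subgroupF // subgroup1. Qed.

Lemma subgroupM x y : x \in (H : set G) -> y \in (H : set G) ->
  x * y \in (H : set G).
Proof. by move=> Hx Hy; rewrite -[y]invgK subgroupF // subgroupV. Qed.

Definition lcoset_rel : rel G := fun x y => x^-1 * y \in (H : set G).

Lemma lcoset_rel_refl : reflexive lcoset_rel.
Proof. by move=> x; rewrite /lcoset_rel mulVg subgroup1. Qed.

Lemma lcoset_rel_sym : symmetric lcoset_rel.
Proof.
by move=> x y; apply/idP/idP => /subgroupV; rewrite invgM invgK.
Qed.

Lemma lcoset_rel_trans : transitive lcoset_rel.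
Proof.
move=> y x z xy yz; rewrite /lcoset_rel -[z](mulVKg y) mulgA.
exact: subgroupM.
Qed.

Canonical lcoset_equiv :=
  EquivRel lcoset_rel lcoset_rel_refl lcoset_rel_sym lcoset_rel_trans.

Definition lcosets := {eq_quot lcoset_equiv}.

HB.instance Definition _ := Choice.on lcosets.
HB.instance Definition _ := EqQuotient.on lcosets.

End LeftCosets.

Definition finite_index H := finite_set [set: lcosets H].
Definition has_index H (n : nat) := ([set: lcosets H] #= `I_n)%card.

End Subgroups.

Record normal_subgroup (G : groupType) := NormalSubgroup {
  normal_sub :> subgroup G;
  normal_conj : forall x y : G,
    (normal_sub : set G) x -> (normal_sub : set G) (x ^ y)
}.

Section Quotient.
Variables (G : groupType) (N : normal_subgroup G).

Definition quotient : Type := lcosets N.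

HB.instance Definition _ := Choice.on quotient.
HB.instance Definition _ := EqQuotient.on quotient.

Implicit Types (x y : G) (u v w : quotient).

Definition quotient_one : quotient := \pi_quotient 1.
Definition quotient_inv u : quotient := \pi_quotient (repr u)^-1.
Definition quotient_mul u v : quotient := \pi_quotient (repr u * repr v).

Lemma quotient_eqP x y :
  (\pi_quotient x = \pi_quotient y :> quotient) <-> x^-1 * y \in (N : set G).
Proof. by split=> /(@eqmodP _ (lcoset_equiv N) x y). Qed.

Lemma normal_mem x y : x \in (N : set G) ->
  x ^ y \in (N : set G).
Proof. by move=> /set_mem Nx; apply/mem_set/normal_conj. Qed.

Lemma quotient_mulE x y :
  quotient_mul (\pi_quotient x) (\pi_quotient y) = \pi_quotient (x * y).
Proof.
apply/quotient_eqP; set x' := repr _; set y' := repr _.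
have Nx : x'^-1 * x \in (N : set G).
  by apply/quotient_eqP; rewrite /x' reprK.
have Ny : y'^-1 * y \in (N : set G).
  by apply/quotient_eqP; rewrite /y' reprK.
suff -> : (x' * y')^-1 * (x * y) = (x'^-1 * x) ^ y' * (y'^-1 * y).
  by apply: subgroupM => //; apply: normal_mem.
by rewrite /conjg invgM !mulgA mulgK.
Qed.

Lemma quotient_invE x : quotient_inv (\pi_quotient x) = \pi_quotient x^-1.
Proof.
apply/quotient_eqP; set x' := repr _.
have Nx : x'^-1 * x \in (N : set G).
  by apply/quotient_eqP; rewrite /x' reprK.
suff -> : x'^-1^-1 * x^-1 = ((x'^-1 * x)^-1) ^ x'^-1.
  by apply/normal_mem/subgroupV.
by rewrite /conjg invgM !invgK !mulgA mulgK.
Qed.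

Lemma quotient_mulA : associative quotient_mul.
Proof.
elim/quotW=> x; elim/quotW=> y; elim/quotW=> z.
by rewrite (quotient_mulE y z) (quotient_mulE x y) !quotient_mulE mulgA.
Qed.

Lemma quotient_mul1 : left_id quotient_one quotient_mul.
Proof. by elim/quotW=> x; rewrite quotient_mulE mul1g. Qed.

Lemma quotient_mulr1 : right_id quotient_one quotient_mul.
Proof. by elim/quotW=> x; rewrite quotient_mulE mulg1. Qed.

Lemma quotient_mulV : left_inverse quotient_one quotient_inv quotient_mul.
Proof. by elim/quotW=> x; rewrite quotient_invE quotient_mulE mulVg. Qed.

Lemma quotient_mulrV : right_inverse quotient_one quotient_inv quotient_mul.
Proof. by elim/quotW=> x; rewrite quotient_invE quotient_mulE mulgV. Qed.

HB.instance Definition _ := isGroup.Build quotient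
  quotient_mulA quotient_mul1 quotient_mulr1 quotient_mulV quotient_mulrV.

End Quotient.

Definition infinite_group (G : groupType) := infinite_set [set: G].

Definition finitely_generated (G : groupType) :=
  exists2 S : set G, finite_set S & generated S = [set: G] :> set G.

Definition torsion_free (G : groupType) :=
  forall (x : G) (n : nat), (0 < n)%N -> x ^+ n = 1 -> x = 1.

Record finite_quotient_kernel (G : groupType) := FiniteQuotientKernel {
  fqk_normal :> normal_subgroup G;
  fqk_finite : finite_index fqk_normal
}.

HB.instance Definition _ (G : groupType) :=
  gen_eqMixin (finite_quotient_kernel G).
HB.instance Definition _ (G : groupType) :=
  gen_choiceMixin (finite_quotient_kernel G).

Definition residually_finite (G : groupType) :=
  forall x : G, x != 1 -> exists N : finite_quotient_kernel G, ~ (N : set G) x.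

HB.structure Definition GroupTopological := {T of Group T & Topological T}.

Section ProfiniteCompletion.
Variable G : groupType.
Implicit Types M N : finite_quotient_kernel G.

(* The canonical projection [G / N -> G / M]; only used when [N `<=` M], where
   it does not depend on the choice of representatives. *)
Definition quotient_proj N M (u : quotient N) : quotient M :=
  \pi_(quotient M) (repr u).

Lemma quotient_projE N M (x : G) : (N : set G) `<=` (M : set G) ->
  quotient_proj M (\pi_(quotient N) x) = \pi_(quotient M) x.
Proof.
move=> NM; apply/quotient_eqP/mem_set/NM/set_mem/quotient_eqP.
by rewrite reprK.
Qed.

Definition quotient_product : Type :=
  prod_topology (fun N => discrete_topology (quotient N)).

HB.instance Definition _ := Topological.on quotient_product.

(* The inverse limit of the finite quotients of [G], with the topology induced
   by the product of the discrete ones. *)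
Definition coherent : set quotient_product :=
  [set u | forall N M, (N : set G) `<=` (M : set G) ->
     quotient_proj M (u N : quotient N) = u M].

Definition profinite_completion : Type := set_type coherent.

HB.instance Definition _ := SubChoice.on profinite_completion.
HB.instance Definition _ := Topological.on profinite_completion.

Implicit Types u v : profinite_completion.

Lemma quotient_projM N M (s t : quotient N) : (N : set G) `<=` (M : set G) ->
  quotient_proj M (s * t) = quotient_proj M s * quotient_proj M t.
Proof.
move=> NM; elim/quotW: s => x; elim/quotW: t => y.
by rewrite [X in quotient_proj _ X]quotient_mulE !quotient_projE //
  [RHS]quotient_mulE.
Qed.

Lemma quotient_projV N M (s : quotient N) : (N : set G) `<=` (M : set G) ->
  quotient_proj M s^-1 = (quotient_proj M s)^-1.
Proof.
move=> NM; elim/quotW: s => x.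
by rewrite [X in quotient_proj _ X]quotient_invE !quotient_projE //
  [RHS]quotient_invE.
Qed.

Definition completion_comp u N : quotient N := val u N.

Lemma completion_comp_inj u v :
  (forall N, completion_comp u N = completion_comp v N) -> u = v.
Proof. by move=> uv; apply/val_inj/functional_extensionality_dep. Qed.

Lemma completion_compP u N M : (N : set G) `<=` (M : set G) ->
  quotient_proj M (completion_comp u N) = completion_comp u M.
Proof. by move=> NM; have /set_mem/(_ N M NM) := valP u. Qed.

Lemma completion_one_subproof :
  ((fun N => 1 : quotient N) : quotient_product) \in coherent.
Proof. by apply/mem_set => N M NM; apply: quotient_projE. Qed.

Lemma completion_inv_subproof u :
  ((fun N => (completion_comp u N)^-1) : quotient_product) \in coherent.
Proof.
by apply/mem_set => N M NM; rewrite quotient_projV // completion_compP.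
Qed.

Lemma completion_mul_subproof u v :
  ((fun N => completion_comp u N * completion_comp v N) : quotient_product)
    \in coherent.
Proof.
by apply/mem_set => N M NM; rewrite quotient_projM // !completion_compP.
Qed.

Definition completion_one : profinite_completion :=
  exist (fun s => s \in coherent) _ completion_one_subproof.
Definition completion_inv u : profinite_completion :=
  exist (fun s => s \in coherent) _ (completion_inv_subproof u).
Definition completion_mul u v : profinite_completion :=
  exist (fun s => s \in coherent) _ (completion_mul_subproof u v).

Lemma completion_mulA : associative completion_mul.
Proof. by move=> u v w; apply: completion_comp_inj => N; apply: mulgA. Qed.

Lemma completion_mul1 : left_id completion_one completion_mul.
Proof. by move=> u; apply: completion_comp_inj => N; apply: mul1g. Qed.

Lemma completion_mulr1 : right_id completion_one completion_mul.
Proof. by move=> u; apply: completion_comp_inj => N; apply: mulg1. Qed.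

Lemma completion_mulV :
  left_inverse completion_one completion_inv completion_mul.
Proof. by move=> u; apply: completion_comp_inj => N; apply: mulVg. Qed.

Lemma completion_mulrV :
  right_inverse completion_one completion_inv completion_mul.
Proof. by move=> u; apply: completion_comp_inj => N; apply: mulgV. Qed.

HB.instance Definition _ := isGroup.Build profinite_completion
  completion_mulA completion_mul1 completion_mulr1
  completion_mulV completion_mulrV.

End ProfiniteCompletion.

Definition topological_group (T : GroupTopological.type) :=
  continuous (fun xy : T * T => xy.1 * xy.2) /\ continuous (fun x : T => x^-1).

Definition profinite_group (T : GroupTopological.type) :=
  [/\ topological_group T, compact [set: T], hausdorff_space T
    & totally_disconnected [set: T]].

Definition pro_p_group (p : nat) (T : GroupTopological.type) :=
  profinite_group T /\
  forall N : normal_subgroup T, open (N : set T) ->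
    exists n, has_index N (p ^ n).

Section TreeAutomorphisms.
Variable p : nat.

(* The letter [x : 'I_p] stands for the element [x.+1] of {1, ..., p}. *)
Definition word : Type := seq 'I_p.

HB.instance Definition _ := Choice.on word.

Implicit Types u v w : word.

Definition adjacent u v : bool :=
  [exists x, v == rcons u x] || [exists x, u == rcons v x].

Definition is_tree_aut (f : word -> word) : Prop :=
  [/\ bijective f, f [::] = [::]
    & forall u v, adjacent (f u) (f v) = adjacent u v].

Record tree_aut := TreeAut {
  tree_aut_fun :> word -> word;
  tree_aut_subproof : `[< is_tree_aut tree_aut_fun >]
}.

HB.instance Definition _ := [isSub for tree_aut_fun].
HB.instance Definition _ := [Choice of tree_aut by <:].

Implicit Types g h : tree_aut.

Lemma tree_autP g : is_tree_aut g.
Proof. exact/asboolP/tree_aut_subproof. Qed.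

Lemma tree_aut_ext g h : g =1 h -> g = h.
Proof. by move=> gh; apply/val_inj/functional_extensionality_dep. Qed.

Lemma is_tree_aut_id : is_tree_aut id.
Proof. by split=> //; exists id. Qed.

Lemma is_tree_aut_comp g h : is_tree_aut (g \o h).
Proof.
have [bg g0 ag] := tree_autP g; have [bh h0 ah] := tree_autP h.
by split=> [||u v]; [exact: bij_comp | rewrite /= h0 | rewrite /= ag ah].
Qed.

Lemma tree_aut_inv_exists g : exists f, cancel g f /\ cancel f g.
Proof. by have [[f gK fK] _ _] := tree_autP g; exists f. Qed.

Definition tree_aut_inv_fun g : word -> word :=
  projT1 (cid (tree_aut_inv_exists g)).

Lemma tree_aut_invK g :
  cancel g (tree_aut_inv_fun g) /\ cancel (tree_aut_inv_fun g) g.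
Proof. exact: projT2 (cid (tree_aut_inv_exists g)). Qed.

Lemma is_tree_aut_inv g : is_tree_aut (tree_aut_inv_fun g).
Proof.
have [bg g0 ag] := tree_autP g; have [gK fK] := tree_aut_invK g.
split=> [||u v]; first by exists g.
- by rewrite -[in LHS]g0 gK.
- by rewrite -ag !fK.
Qed.

Definition tree_aut_one : tree_aut := TreeAut (asboolT is_tree_aut_id).
Definition tree_aut_mul g h : tree_aut :=
  TreeAut (asboolT (is_tree_aut_comp g h)).
Definition tree_aut_inv g : tree_aut := TreeAut (asboolT (is_tree_aut_inv g)).

Lemma tree_aut_mulA : associative tree_aut_mul.
Proof. by move=> f g h; apply: tree_aut_ext. Qed.

Lemma tree_aut_mul1 : left_id tree_aut_one tree_aut_mul.
Proof. by move=> g; apply: tree_aut_ext. Qed.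

Lemma tree_aut_mulr1 : right_id tree_aut_one tree_aut_mul.
Proof. by move=> g; apply: tree_aut_ext. Qed.

Lemma tree_aut_mulV : left_inverse tree_aut_one tree_aut_inv tree_aut_mul.
Proof.
by move=> g; have [gK _] := tree_aut_invK g; apply: tree_aut_ext => w /=.
Qed.

Lemma tree_aut_mulrV : right_inverse tree_aut_one tree_aut_inv tree_aut_mul.
Proof.
by move=> g; have [_ fK] := tree_aut_invK g; apply: tree_aut_ext => w /=.
Qed.

HB.instance Definition _ := isGroup.Build tree_aut
  tree_aut_mulA tree_aut_mul1 tree_aut_mulr1 tree_aut_mulV tree_aut_mulrV.

Lemma is_tree_aut_prefix (f : word -> word) :
  bijective f -> f [::] = [::] -> (forall w, size (f w) = size w) ->
  (forall u x, exists y, f (rcons u x) = rcons (f u) y) -> is_tree_aut f.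
Proof.
move=> bf f0 sf pf; have fI := bij_inj bf; split=> // u v.
have half s t : [exists y, f t == rcons (f s) y] = [exists x, t == rcons s x].
  apply/existsP/existsP => -[y /eqP].
  - case/lastP: t => [|t x] E.
      by move/(congr1 size): E; rewrite f0 size_rcons.
    have [z Ez] := pf t x; move: E; rewrite Ez => /rcons_inj[/fI -> _].
    by exists x.
  - by move=> ->; have [z ->] := pf s y; exists z.
by rewrite /adjacent !half.
Qed.

End TreeAutomorphisms.

Section GGS.
Variable p : nat.
Implicit Types (x : 'I_p) (v w : word p).

Definition rooted_cycle_fun w : word p :=
  if w is x :: v then ordS x :: v else [::].

Lemma is_tree_aut_rooted_cycle : is_tree_aut rooted_cycle_fun.
Proof.
apply: is_tree_aut_prefix => //.
- exists (fun w : word p => if w is x :: v then ord_pred x :: v else [::]).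
  + by case=> //= x v; rewrite ordSK.
  + by case=> //= x v; rewrite ord_predK.
- by case.
- by case=> [|y u] x; [exists (ordS x) | exists x].
Qed.

Definition ggs_a : tree_aut p := TreeAut (asboolT is_tree_aut_rooted_cycle).

Variable e : 'rV['F_p]_p.-1.

(* [ggs_b_fun (x :: v) = x :: b_x v] where the section [b_x] is [a^(e_x)] for
   the first [p - 1] letters and [b] itself for the last one. *)
Fixpoint ggs_b_fun w : word p :=
  if w is x :: v then
    x :: (if insub (val x) is Some i then (ggs_a ^+ (e ord0 i : 'F_p)) v
          else ggs_b_fun v)
  else [::].

Fixpoint ggs_b_inv_fun w : word p :=
  if w is x :: v then
    x :: (if insub (val x) is Some i then (ggs_a ^+ (e ord0 i : 'F_p))^-1 v
          else ggs_b_inv_fun v)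
  else [::].

Lemma ggs_a_expE n w :
  (ggs_a ^+ n) w = if w is x :: v then iter n (@ordS p) x :: v else [::].
Proof.
elim: n w => [|n IHn] w; first by rewrite expg0; case: w.
by rewrite expgS /= IHn; case: w.
Qed.

Lemma ggs_a_exp_rcons n w x :
  exists y, (ggs_a ^+ n) (rcons w x) = rcons ((ggs_a ^+ n) w) y.
Proof.
rewrite !ggs_a_expE.
by case: w => [|z w]; [exists (iter n (@ordS p) x) | exists x].
Qed.

Lemma is_tree_aut_ggs_b : is_tree_aut ggs_b_fun.
Proof.
apply: is_tree_aut_prefix => //.
- exists ggs_b_inv_fun; elim=> //= x v IHv; congr (_ :: _);
    case: insub => [i|//]; set g := _ ^+ _.
  + by have [gK _] := tree_aut_invK g; apply: gK.
  + by have [_ gK] := tree_aut_invK g; apply: gK.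
- elim=> //= x v IHv; case: insub => [i|]; last by rewrite IHv.
  by rewrite ggs_a_expE; case: v {IHv}.
- elim=> [|y u IHu] x /=.
  + by exists x; case: insub => [i|//]; rewrite ggs_a_expE.
  + case: insub => [i|].
    * by have [z ->] := ggs_a_exp_rcons (e ord0 i : 'F_p) u x; exists z.
    * by have [z ->] := IHu x; exists z.
Qed.

Definition ggs_b : tree_aut p := TreeAut (asboolT is_tree_aut_ggs_b).

Definition ggs_group : subgroup (tree_aut p) := generated [set ggs_a; ggs_b].

End GGS.

(* Main.v *)
(* Idea. Write a^s b^r for the class of an element of G modulo G', and mu for
   lambda - 1. If g is in G' and r_k is the b-exponent of its k-th section, the
   a-exponent of that section is mu r_(k+1) - r_k. As mu is not 1, either all
   r_k vanish or some section has both exponents nonzero. In the latter case g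
   has infinite order: if h is in the class of a^s b^r with s, r nonzero, every
   section of h^p is in the class of a^((lambda - 2) r) b^r. In the former case
   one goes down the tree, so G' is torsion-free.
   Since lambda <> 1, G' contains the copy of G' acting below any vertex, and
   the sections of G' at the first level exhaust G. Hence a nontrivial subgroup
   K of Aut T normalized by G contains, for some n, the copies of gamma_3(G)
   below all vertices of level n, and g^(p^(n+2)) is in K for all g in G, since
   G / gamma_3(G) has exponent dividing p^2. A normal subgroup M of index k in
   G' contains all k-th powers of elements of G', hence such a K; so G' / M is a
   p-group. *)
From mathcomp Require Import all_boot fingroup cyclic pgroup.
Require Import Defs.
From HB Require Import structures.
From mathcomp Require Import all_boot all_order all_algebra generic_quotient.
From mathcomp Require Import all_classical topology.
From mathcomp Require Import ring zify.

Set Implicit Arguments.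
Unset Strict Implicit.
Unset Printing Implicit Defensive.

Import GRing.Theory.

Local Open Scope classical_set_scope.
Local Open Scope quotient_scope.
Local Open Scope group_scope.

(** * Subgroups and commutators *)

Notation "x \insub H" := (subgroup_set H x) (at level 70, no associativity).

Arguments subgroup_set : simpl never.

Section SubgroupTheory.
Variable G : groupType.
Implicit Types (H K N : subgroup G) (S : set G) (x y z g h : G).

Lemma group_closedP (P : set G) : P 1 ->
  (forall x y, P x -> P y -> P (x / y)) -> group_closed (mem P).
Proof.
move=> P1 PF; split; first exact: mem_set.
by move=> x y /set_mem Px /set_mem Py; apply/mem_set/PF.
Qed.

Lemma sub1 H : 1 \insub H. Proof. exact/set_mem/subgroup1. Qed.

Lemma subV H x : x \insub H -> x^-1 \insub H.
Proof. by move=> /mem_set/subgroupV/set_mem. Qed.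

Lemma subM H x y : x \insub H -> y \insub H -> x * y \insub H.
Proof. by move=> /mem_set Hx /mem_set Hy; apply/set_mem/subgroupM. Qed.

Lemma subF H x y : x \insub H -> y \insub H -> x / y \insub H.
Proof. by move=> Hx Hy; apply: subM => //; apply: subV. Qed.

Lemma subX H x n : x \insub H -> x ^+ n \insub H.
Proof.
move=> Hx; elim: n => [|n IH]; first by rewrite expg0; exact: sub1.
by rewrite expgS; exact: subM.
Qed.

Lemma subJ H x y : x \insub H -> y \insub H -> x ^ y \insub H.
Proof. by move=> Hx Hy; apply: subM; [exact: subV | exact: subM]. Qed.

Lemma subR H x y : x \insub H -> y \insub H -> [~ x, y] \insub H.
Proof. by move=> Hx Hy; apply: subM; [exact: subV | exact: subJ]. Qed.

Lemma subVE H x : x^-1 \insub H -> x \insub H.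
Proof. by move=> /subV; rewrite invgK. Qed.

Lemma gen_mem S x : S x -> x \insub generated S.
Proof. by move=> Sx A [_]; apply. Qed.

Lemma gen_ind S (P : G -> Prop) : P 1 ->
  (forall x y, P x -> P y -> P (x / y)) -> (forall x, S x -> P x) ->
  forall x, x \insub generated S -> P x.
Proof.
by move=> P1 PF SP x /(_ P); apply; split=> //; apply: group_closedP.
Qed.

Lemma gen_min S H x : (forall y, S y -> y \insub H) ->
  x \insub generated S -> x \insub H.
Proof.
by move=> SH; move: x; apply: gen_ind => [|x y|//]; [exact: sub1 | exact: subF].
Qed.

Lemma genJ S x y : (forall z, S z -> z ^ y \insub generated S) ->
  x \insub generated S -> x ^ y \insub generated S.
Proof.
move=> Sy; move: x; apply: gen_ind => [|u v Hu Hv|//].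
  by rewrite conj1g; exact: sub1.
by rewrite conjMg conjVg; apply: subF.
Qed.

Definition comm_subgroup H K : subgroup G :=
  generated [set z | exists x y, [/\ x \insub H, y \insub K & z = [~ x, y]]].

Lemma comm_mem H K x y :
  x \insub H -> y \insub K -> [~ x, y] \insub comm_subgroup H K.
Proof. by move=> Hx Ky; apply: gen_mem; exists x, y. Qed.

Lemma comm_min H K N x : (forall y z, y \insub H -> z \insub K ->
  [~ y, z] \insub N) -> x \insub comm_subgroup H K -> x \insub N.
Proof. by move=> HKN; apply: gen_min => _ [y [z [Hy Kz ->]]]; apply: HKN. Qed.

Definition normalizes N y := forall x, x \insub N -> x ^ y \insub N.

Lemma comm_normal H K g : normalizes H g -> normalizes K g ->
  normalizes (comm_subgroup H K) g.
Proof.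
move=> Hg Kg x; apply: genJ => _ [u [v [Hu Kv ->]]]; rewrite conjRg.
by apply: comm_mem; [apply: Hg | apply: Kg].
Qed.

Lemma normalizes_self H g : g \insub H -> normalizes H g.
Proof. by move=> Hg x Hx; apply: subJ. Qed.

Lemma derived_normal H g : g \insub H -> normalizes (comm_subgroup H H) g.
Proof. by move=> Hg; apply: comm_normal; apply: normalizes_self. Qed.

Lemma derived_sub H x : x \insub comm_subgroup H H -> x \insub H.
Proof. by apply: comm_min => y z; apply: subR. Qed.

Lemma commg_sym_sub N x y : [~ x, y] \insub N -> [~ y, x] \insub N.
Proof. by rewrite -invgR; apply: subVE. Qed.

Lemma commgMr x y z : [~ x, y * z] = [~ x, z] * [~ x, y] ^ z.
Proof. by rewrite /commg /conjg !gnorm. Qed.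

Lemma commgMl x y z : [~ x * y, z] = [~ x, z] ^ y * [~ y, z].
Proof. by rewrite /commg /conjg !gnorm. Qed.

Lemma commgVr x y : [~ x, y^-1] = ([~ x, y] ^ y^-1)^-1.
Proof. by rewrite /commg /conjg !gnorm. Qed.

Section ModuloNormal.
Variables (H N : subgroup G).
Hypothesis HN : forall g, g \insub H -> normalizes N g.

Lemma commg_gen_sub S x y : (forall z, S z -> z \insub H) ->
  (forall z, S z -> [~ x, z] \insub N) ->
  y \insub generated S -> [~ x, y] \insub N.
Proof.
move=> SH SN yS; suff [] : y \insub H /\ [~ x, y] \insub N by [].
move: y yS; apply: gen_ind => [|u v [Hu Nu] [Hv Nv]|z Sz]; last by split; auto.
  by rewrite commg1; split; exact: sub1.
have Hv' := subV Hv; split; first exact: subF.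
by rewrite commgMr commgVr; apply: subM; [apply/subV/HN | apply: HN].
Qed.

(** Modulo [N], the elements commuting with a fixed one form a subgroup. This is applied with the
    fixed element equal to [a], then to [b], then to an arbitrary element of [H]. *)
Lemma derived_gen2_sub a b x : H = generated [set a; b] ->
  [~ a, b] \insub N -> x \insub comm_subgroup H H -> x \insub N.
Proof.
move=> defH Nab; have SH z : [set a; b] z -> z \insub H.
  by rewrite defH; apply: gen_mem.
have Na y : y \insub H -> [~ a, y] \insub N.
  rewrite [X in _ \insub X]defH; apply: commg_gen_sub => // z [->|->] //.
  by rewrite commgg; apply: sub1.
have Nb y : y \insub H -> [~ b, y] \insub N.
  rewrite [X in _ \insub X]defH; apply: commg_gen_sub => // z [->|->] //.
    exact: commg_sym_sub.
  by rewrite commgg; apply: sub1.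
apply: comm_min => u v Hu; rewrite [X in _ \insub X]defH.
by apply: commg_gen_sub => // z [->|->]; apply: commg_sym_sub; auto.
Qed.

Lemma expgM_modulo c d n :
  (forall x y, x \insub H -> y \insub H -> [~ x, y] \insub N) ->
  c \insub H -> d \insub H ->
  exists2 l, l \insub N & (c * d) ^+ n = c ^+ n * d ^+ n * l.
Proof.
move=> HHN Hc Hd; elim: n => [|n [l Nl IH]].
  by exists 1; [exact: sub1 | rewrite !expg0 !mulg1].
(* In c^n d^n l c d, the factor c is moved left past l and d^n, and then d past the element of [N]
   so obtained. *)
exists (([~ d ^+ n, c] * l ^ c) ^ d).
  apply: HN => //; apply: subM; last exact: HN.
  by apply: HHN => //; apply: subX.
by rewrite expgSr IH !expgSr /commg /conjg !gnorm.
Qed.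

Lemma exponent_modulo S x n :
  (forall x y, x \insub H -> y \insub H -> [~ x, y] \insub N) ->
  (forall z, S z -> z \insub H /\ z ^+ n \insub N) ->
  x \insub generated S -> x ^+ n \insub N.
Proof.
move=> HHN SN xS; suff [] : x \insub H /\ x ^+ n \insub N by [].
move: x xS; apply: gen_ind => [|u v [Hu Nu] [Hv Nv]|//].
  by rewrite expg1n; split; exact: sub1.
split; first exact: subF.
have [l Nl ->] := expgM_modulo n HHN Hu (subV Hv).
by rewrite expVgn; apply: subM => //; apply: subF.
Qed.

End ModuloNormal.

(** The identity [x^(n+1), y] = [x^n, y]^x [x, y] gives the induction, because conjugation by x acts
    trivially on H' modulo [N]. *)
Lemma commXg_modulo H N x y n : (forall g, g \insub H -> normalizes N g) ->
  (forall u, u \insub comm_subgroup H H -> [~ u, x] \insub N) ->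
  x \insub H -> y \insub H ->
  exists2 l, l \insub N & [~ x ^+ n, y] = [~ x, y] ^+ n * l.
Proof.
move=> HN HHN Hx Hy; elim: n => [|n [l Nl IH]].
  by exists 1; [exact: sub1 | rewrite !expg0 comm1g mulg1].
exists ((l * [~ [~ x ^+ n, y], x]) ^ [~ x, y]).
  apply: HN; first exact: subR.
  by apply: subM => //; apply: HHN; apply: comm_mem => //; apply: subX.
have -> : [~ x ^+ n.+1, y] =
    [~ x ^+ n, y] * [~ [~ x ^+ n, y], x] * [~ x, y].
  by rewrite expgSr commgMl [in RHS]commgEl mulVKg.
by rewrite {1}IH expgSr; set c := [~ x, y]; rewrite /conjg !gnorm.
Qed.

(** Modulo gamma_3(H), the n-th power of [u, v] is [u^n, v], which is trivial because u^n lies in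
    H'. Since H' / gamma_3(H) is abelian, its exponent divides n; the other factor n comes from H /
    H'. *)
Lemma exponent_lower_central H n :
  (forall x, x \insub H -> x ^+ n \insub comm_subgroup H H) ->
  forall x, x \insub H ->
    x ^+ (n * n) \insub comm_subgroup (comm_subgroup H H) H.
Proof.
move=> Hn x Hx; set N := comm_subgroup _ H.
have NJ g : g \insub H -> normalizes N g.
  move=> Hg; apply: comm_normal; first exact: derived_normal.
  exact: normalizes_self.
rewrite expgnA; apply: (@exponent_modulo (comm_subgroup H H) N _ _ _ n);
  last exact: Hn.
- by move=> g /derived_sub; apply: NJ.
- by move=> u v Hu /derived_sub Hv; apply: comm_mem.
- move=> _ [u [v [Hu Hv ->]]]; split; first exact: comm_mem.
  have [|l Nl E] := @commXg_modulo H N u v n NJ _ Hu Hv.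
    by move=> w Hw; apply: comm_mem.
  rewrite -[_ ^+ n](mulgK l) -E; apply: subF => //.
  by apply: comm_mem => //; apply: Hn.
Qed.

(** The relation [a^i, b^j]^(a^k) = [a^(i+k), b^j] [a^k, b^j]^-1 and its analogue for b show that
    these commutators generate a normal subgroup of H, which contains [a, b]. Reducing exponents
    modulo n leaves finitely many of them. *)
Lemma derived_generators a b n : (0 < n)%N -> a ^+ n = 1 -> b ^+ n = 1 ->
  let H := generated [set a; b] in
  comm_subgroup H H =
    generated [set z | exists i j, [/\ (i < n)%N, (j < n)%N
                                     & z = [~ a ^+ i, b ^+ j]]] :> set G.
Proof.
move=> n0 an bn H; set S := [set z | _]; set N := generated S.
have Ha : a \insub H by apply: gen_mem; left.
have Hb : b \insub H by apply: gen_mem; right.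
have modn_exp (c : G) i : c ^+ n = 1 -> c ^+ (i %% n) = c ^+ i.
  by move=> cn; rewrite [in RHS](divn_eq i n) expgnDr mulnC expgnA cn expg1n mul1g.
have NS i j : [~ a ^+ i, b ^+ j] \insub N.
  apply: gen_mem; exists (i %% n)%N, (j %% n)%N.
  by split; rewrite ?ltn_mod ?modn_exp.
have Nak k : normalizes N (a ^+ k).
  move=> x; apply: genJ => _ [i [j [_ _ ->]]].
  have E := commgMl (a ^+ i) (a ^+ k) (b ^+ j).
  by rewrite -[X in X \insub _](mulgK [~ a ^+ k, b ^+ j]) -E -expgnDr; apply: subF.
have Nbk k : normalizes N (b ^+ k).
  move=> x; apply: genJ => _ [i [j [_ _ ->]]].
  have E := commgMr (a ^+ i) (b ^+ j) (b ^+ k).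
  rewrite -[X in X \insub _](mulKg [~ a ^+ i, b ^+ k]) -E -expgnDr.
  by apply: subM => //; apply: subV.
have invX (c : G) : c ^+ n = 1 -> c^-1 = c ^+ n.-1.
  by move=> cn; apply: mulg1_eq; rewrite -expgS prednK.
have NH g : g \insub H -> normalizes N g.
  suff NP : g \insub H -> normalizes N g /\ normalizes N g^-1 by move=> /NP[].
  move: g; apply: gen_ind => [|u v [u1 u2] [v1 v2]|_ [->|->]].
  - by rewrite invg1; split=> x; rewrite conjg1.
  - split=> x Nx; first by rewrite conjgM; apply: v2; apply: u1.
    by rewrite invgM invgK conjgM; apply: u2; apply: v1.
  - by rewrite invX //; split=> //; rewrite -[a]expg1.
  - by rewrite invX //; split=> //; rewrite -[b]expg1.
apply/seteqP; split=> x.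
  apply: (@derived_gen2_sub H N NH a b) => //.
  by have := NS 1%N 1%N; rewrite !expg1.
by apply: gen_min => _ [i [j [_ _ ->]]]; apply: comm_mem; apply: subX.
Qed.

End SubgroupTheory.

(** * Subgroups as groups in their own right *)

Section SubgroupType.
Variables (G : groupType) (H : subgroup G).

Lemma valP_sub (x : subgroup_type H) : val x \insub H.
Proof. exact: set_mem (valP x). Qed.

Lemma sub_val x : x \insub H -> exists u : subgroup_type H, val u = x.
Proof.
by move=> /mem_set Hx; exists (exist (fun s => s \in (H : set G)) x Hx).
Qed.

Lemma gen_subgroup_type S : generated S = H :> set G ->
  generated (val @^-1` S) = [set: subgroup_type H] :> set _.
Proof.
move=> defH; apply/seteqP; split=> // u _; set K := generated _.
suff HP y : y \insub H -> exists2 v : subgroup_type H, v \insub K & val v = y.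
  by have [v Kv /val_inj <-] := HP _ (valP_sub u).
rewrite -[X in X _ -> _]defH.
move: y; apply: gen_ind => [|x y [v Kv <-] [w Kw <-]|y Sy].
- by exists 1; [exact: sub1 | rewrite gmulf1].
- by exists (v / w); [exact: subF | rewrite gmulfF].
have /sub_val [v vy] : y \insub H by rewrite -defH; apply: gen_mem.
by exists v => //; apply: gen_mem; rewrite /= vy.
Qed.

(** This lets the derived subgroup be studied inside the ambient group, without nested subtypes. *)
Lemma derived_subgroup_val (u : subgroup_type H) :
  u \insub derived_subgroup (subgroup_type H) <->
  val u \insub comm_subgroup H H.
Proof.
split.
  move: u; apply: gen_ind => [|x y|_ [x [y ->]]].
  - by rewrite gmulf1 => *; exact: sub1.
  - by rewrite gmulfF; apply: subF.
  - by rewrite gmulfR; apply: comm_mem; apply: valP_sub.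
set D := derived_subgroup _ => uD.
suff [v Dv /val_inj <- //] :
  exists2 v : subgroup_type H, v \insub D & val v = val u.
move: (val u) uD; apply: gen_ind => [|x y [v Kv <-] [w Kw <-]
  |_ [_ [_ [/sub_val [v <-] /sub_val [w <-] ->]]]].
- by exists 1; [exact: sub1 | rewrite gmulf1].
- by exists (v / w); [exact: subF | rewrite gmulfF].
- by exists [~ v, w]; [apply: gen_mem; exists v, w | rewrite gmulfR].
Qed.

End SubgroupType.

(** * Sections of tree automorphisms *)

Section Sections.
Variable p : nat.
Implicit Types (g h : tree_aut p) (u v w : word p) (x y : 'I_p).

Lemma tree_aut_nil g : g [::] = [::]. Proof. by have [] := tree_autP g. Qed.

Lemma tree_aut_inj g : injective g.
Proof. by have [/bij_inj] := tree_autP g. Qed.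

(** The image of a child of u is a neighbour of g u. It is not the parent of g u, which by induction
    is already the image of the parent of u. *)
Lemma tree_aut_rcons g u x : exists y, g (rcons u x) = rcons (g u) y.
Proof.
have adj v z : adjacent (g v) (g (rcons v z)).
  have [_ _ ->] := tree_autP g.
  by rewrite /adjacent; apply/orP; left; apply/existsP; exists z.
elim/last_ind: u x => [|u z IH] x.
  have := adj [::] x; rewrite /adjacent => /orP[/existsP[y /eqP E]|].
    by exists y.
  by case/existsP => y /eqP; rewrite tree_aut_nil; case: (g _).
have := adj (rcons u z) x; rewrite /adjacent => /orP[/existsP[y /eqP E]|].
  by exists y.
case/existsP => y /eqP.
have [y' ->] := IH z => /rcons_inj[/tree_aut_inj E _].
by move/(congr1 size)/eqP: E; rewrite !size_rcons
  -[X in X == _]addn0 -addn2 eqn_add2l.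
Qed.

Lemma tree_aut_size g u : size (g u) = size u.
Proof.
elim/last_ind: u => [|u x IH]; first by rewrite tree_aut_nil.
by have [y ->] := tree_aut_rcons g u x; rewrite !size_rcons IH.
Qed.

(** The section is taken at an arbitrary vertex, fixed or not: g(vw) = g(v) g_v(w). *)
Definition section_fun g v w : word p := drop (size v) (g (v ++ w)).

Lemma section_funE g v w : g (v ++ w) = g v ++ section_fun g v w.
Proof.
rewrite /section_fun; elim/last_ind: w => [|w x IH].
  by rewrite cats0 drop_oversize ?cats0 // tree_aut_size.
rewrite -rcons_cat; have [y ->] := tree_aut_rcons g (v ++ w) x.
rewrite drop_rcons; last by rewrite tree_aut_size size_cat leq_addr.
by rewrite -rcons_cat -IH.
Qed.

Lemma mulE g h w : (g * h) w = g (h w). Proof. by []. Qed.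

Lemma oneE w : (1 : tree_aut p) w = w. Proof. by []. Qed.

Lemma fixV g w : g w = w -> g^-1 w = w.
Proof. by move=> gw; rewrite -{1}gw -mulE mulVg. Qed.

Lemma is_tree_aut_section g v : is_tree_aut (section_fun g v).
Proof.
(* For mutually inverse automorphisms, the section of one at u is inverted by the section of the
   other at the image of u. *)
have K h k u w : k * h = 1 -> section_fun k (h u) (section_fun h u w) = w.
  move=> kh; rewrite /section_fun tree_aut_size -section_funE.
  by rewrite -mulE kh drop_size_cat.
apply: is_tree_aut_prefix.
- exists (section_fun g^-1 (g v)) => w; first by rewrite K ?mulVg.
  by rewrite -[v in section_fun g v](oneE v) -(mulVg g) mulE K // mulgV.
- by rewrite /section_fun cats0 drop_oversize // tree_aut_size.
- by move=> w; rewrite /section_fun size_drop tree_aut_size size_cat addKn.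
- move=> u x; rewrite /section_fun -rcons_cat.
  have [y ->] := tree_aut_rcons g (v ++ u) x; exists y.
  by rewrite drop_rcons // tree_aut_size size_cat leq_addr.
Qed.

Definition section g v : tree_aut p :=
  TreeAut (asboolT (is_tree_aut_section g v)).

Lemma sectionE g v w : g (v ++ w) = g v ++ section g v w.
Proof. exact: section_funE. Qed.

Lemma section_eq g v h : (forall w, g (v ++ w) = g v ++ h w) -> section g v = h.
Proof.
move=> gh; apply: tree_aut_ext => w; have := gh w; rewrite sectionE.
by move/(congr1 (drop (size (g v)))); rewrite !drop_size_cat.
Qed.

Lemma section_nil g : section g [::] = g.
Proof. by apply: section_eq => w; rewrite tree_aut_nil. Qed.

Lemma section_cat g u v : section g (u ++ v) = section (section g u) v.
Proof.
apply: section_eq => w.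
by rewrite -catA sectionE [section g u _]sectionE catA -sectionE.
Qed.

Lemma section1 v : section 1 v = 1. Proof. exact: section_eq. Qed.

Lemma sectionM g h v : section (g * h) v = section g (h v) * section h v.
Proof. by apply: section_eq => w; rewrite !mulE !sectionE. Qed.

Lemma sectionV g v : section g^-1 v = (section g (g^-1 v))^-1.
Proof.
apply/esym/mulg1_eq; rewrite -sectionM mulgV; exact: section1.
Qed.

Lemma sectionX g v n : g v = v -> section (g ^+ n) v = section g v ^+ n.
Proof.
move=> gv; elim: n => [|n IH]; first by rewrite !expg0 section1.
by rewrite !expgSr sectionM gv IH.
Qed.

(** The action on the first level. The default of [head] is never returned, since g preserves
    lengths. *)
Definition letter g x : 'I_p := head x (g [:: x]).

Lemma letterE g x : g [:: x] = [:: letter g x].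
Proof.
by have := tree_aut_size g [:: x]; rewrite /letter; case: (g _) => [|y []].
Qed.

Lemma cons_letterE g x w : g (x :: w) = letter g x :: section g [:: x] w.
Proof. by rewrite -cat1s sectionE letterE. Qed.

Lemma letter_eq g x y : g [:: x] = [:: y] -> letter g x = y.
Proof. by rewrite letterE => -[]. Qed.

Lemma letterM g h x : letter (g * h) x = letter g (letter h x).
Proof. by apply: letter_eq; rewrite mulE !letterE. Qed.

Lemma letter1 x : letter 1 x = x. Proof. by []. Qed.

Lemma letterVK g x : letter g (letter g^-1 x) = x.
Proof. by rewrite -letterM mulgV. Qed.

Lemma letter_inj g : injective (letter g).
Proof.
move=> x y xy; have := @tree_aut_inj g [:: x] [:: y].
by rewrite !letterE xy => /(_ erefl)[].
Qed.

Lemma letterV_fix g x : letter g x = x -> letter g^-1 x = x.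
Proof. by move=> gx; apply: (@letter_inj g); rewrite letterVK gx. Qed.

Lemma tree_aut_eq1 g h : letter g =1 letter h ->
  (forall x, section g [:: x] = section h [:: x]) -> g = h.
Proof.
move=> ghl ghs; apply: tree_aut_ext => -[|x w]; first by rewrite !tree_aut_nil.
by rewrite !cons_letterE ghl ghs.
Qed.

Section LevelStabilizer.
Definition st1 g := forall x, letter g x = x.

Lemma st1M g h : st1 g -> st1 h -> st1 (g * h).
Proof. by move=> gs hs x; rewrite letterM hs gs. Qed.

Lemma st1V g : st1 g -> st1 g^-1.
Proof. by move=> gs x; apply: letterV_fix. Qed.

Lemma st1X g n : st1 g -> st1 (g ^+ n).
Proof.
move=> gs; elim: n => [|n IH]; first by rewrite expg0.
by rewrite expgS; apply: st1M.
Qed.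

Lemma st1_word g x : st1 g -> g [:: x] = [:: x].
Proof. by move=> gs; rewrite letterE gs. Qed.

Lemma sec_st1M g h x : st1 h ->
  section (g * h) [:: x] = section g [:: x] * section h [:: x].
Proof. by move=> hs; rewrite sectionM st1_word. Qed.

Lemma sec_st1V g x : st1 g -> section g^-1 [:: x] = (section g [:: x])^-1.
Proof. by move=> gs; rewrite sectionV st1_word //; apply: st1V. Qed.

Lemma sec_st1R g h x : st1 g -> st1 h ->
  section [~ g, h] [:: x] = [~ section g [:: x], section h [:: x]].
Proof.
move=> gs hs; have gs' := st1V gs; have hs' := st1V hs.
by rewrite /commg /conjg !sec_st1M ?sec_st1V //; do !apply: st1M.
Qed.

Lemma st1R g h : st1 g -> st1 h -> st1 [~ g, h].
Proof. by move=> gs hs; do ![apply: st1M | apply: st1V]. Qed.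

End LevelStabilizer.

(** * Copies of an automorphism below a vertex *)

Definition plant1_fun x h w : word p :=
  if w is y :: w' then y :: (if y == x then h w' else w') else [::].

Lemma is_tree_aut_plant1 x h : is_tree_aut (plant1_fun x h).
Proof.
have K g k : k * g = 1 -> cancel (plant1_fun x g) (plant1_fun x k).
  move=> kg [|y w] //=; congr (_ :: _).
  by case: eqP => // _; rewrite -mulE kg.
apply: is_tree_aut_prefix => //.
- by exists (plant1_fun x h^-1); apply: K; rewrite ?mulVg ?mulgV.
- by case=> [|y w] //=; case: eqP; rewrite ?tree_aut_size.
- case=> [|y u] z /=; first by exists z; rewrite tree_aut_nil if_same.
  case: eqP => _; last by exists z.
  by have [t ->] := tree_aut_rcons h u z; exists t.
Qed.

Definition plant1 x h : tree_aut p :=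
  TreeAut (asboolT (is_tree_aut_plant1 x h)).

Definition plant v h : tree_aut p := foldr plant1 h v.

Lemma letter_plant1 x h : st1 (plant1 x h). Proof. by []. Qed.

Lemma section_plant1 x h y :
  section (plant1 x h) [:: y] = if y == x then h else 1.
Proof. by apply: section_eq => w /=; case: eqP; rewrite /= ?tree_aut_nil. Qed.

Lemma plant1F x : {morph plant1 x : g h / g / h}.
Proof.
move=> g h; apply: tree_aut_eq1 => y.
  by rewrite letterM (st1V (@letter_plant1 x h)) !letter_plant1.
rewrite sec_st1M ?sec_st1V ?section_plant1 //; last exact: st1V.
by case: eqP; rewrite ?invg1 ?mulg1.
Qed.

HB.instance Definition _ x :=
  isGroupMorphism.Build (tree_aut p) (tree_aut p) (plant1 x) (@plant1F x).

Lemma plantF v : {morph plant v : g h / g / h}.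
Proof.
elim: v => // x v IH g h; rewrite -[LHS]/(plant1 x (plant v (g / h))).
by rewrite IH plant1F.
Qed.

HB.instance Definition _ v :=
  isGroupMorphism.Build (tree_aut p) (tree_aut p) (plant v) (@plantF v).

Lemma plant_cat u v h : plant (u ++ v) h = plant u (plant v h).
Proof. exact: foldr_cat. Qed.

Lemma plant_cons x v h : plant (x :: v) h = plant1 x (plant v h).
Proof. by []. Qed.

(** The automorphism g carries the subtree at u onto the subtree at v, acting between them as its
    section at u. *)
Lemma plant_conj u v g h : g u = v -> plant v h ^ g = plant u (h ^ section g u).
Proof.
elim: u v g h => [|y u IH] v g h.
  by rewrite tree_aut_nil => <- /=; rewrite section_nil.
rewrite cons_letterE; case: v => [|x v] // [<- suv].
rewrite !plant_cons -[y :: u]cat1s section_cat -(IH v) //.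
set k := plant v h; set s := section g _.
suff E : plant1 (letter g y) k * g = g * plant1 y (k ^ s).
  by rewrite /(_ ^ g) E mulKg.
apply: tree_aut_eq1 => z.
  by rewrite !letterM !letter_plant1.
rewrite !sectionM letterE st1_word // !section_plant1 (inj_eq (@letter_inj g)).
by case: eqP => [->|_]; rewrite ?mul1g ?mulg1 // /conjg mulVKg.
Qed.

(** The subtrees below distinct vertices of one level are disjoint, so the two copies have disjoint
    supports. *)
Lemma plant_commute u v g h : size u = size v -> u != v ->
  commute (plant u g) (plant v h).
Proof.
elim: u v => [|x u IH] [|y v] // [uv]; rewrite eqseq_cons.
case: eqVneq => [<-|nxy]; rewrite ?andTb => nuv.
  have C := IH _ uv nuv.
  by rewrite /commute !plant_cons -!gmulfM C.
rewrite /commute !plant_cons; apply: tree_aut_eq1 => z.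
  by rewrite !letterM !letter_plant1.
rewrite !sec_st1M // !section_plant1.
by case: eqP => [->|]; rewrite ?(negPf nxy) ?mul1g ?mulg1.
Qed.

Lemma section_plant_prod (f : 'I_p -> tree_aut p) (s : seq 'I_p) : uniq s ->
  st1 (\prod_(x <- s) plant1 x (f x)) /\ forall y,
    section (\prod_(x <- s) plant1 x (f x)) [:: y] = if y \in s then f y else 1.
Proof.
elim: s => [|x s IH] /=; first by split=> [x|y]; rewrite big_nil //; exact: section1.
case/andP=> xs /IH[s1 sE]; rewrite big_cons; split=> [|y]; first exact: st1M.
rewrite sec_st1M // sE section_plant1 inE.
by case: eqP => [->|_] /=; rewrite ?(negPf xs) ?mulg1 ?mul1g.
Qed.

(** An element of the first level stabilizer is the product of the copies of its sections below the
    letters. *)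
Lemma st1_sub (K : subgroup (tree_aut p)) g : st1 g ->
  (forall x, plant1 x (section g [:: x]) \insub K) -> g \insub K.
Proof.
move=> g1 gK; have [] := @section_plant_prod (fun x => section g [:: x])
  (enum 'I_p) (enum_uniq _).
move=> s1 sE; rewrite (@tree_aut_eq1 g (\prod_(x <- enum 'I_p)
  plant1 x (section g [:: x]))).
- by elim/big_ind: _ => *; [exact: sub1 | exact: subM | exact: gK].
- by move=> x; rewrite s1 g1.
- by move=> x; rewrite sE mem_enum.
Qed.

End Sections.

(** * Exponent sums of sections *)

Section PrimeField.
Variables (p : nat) (p_pr : prime p).

(** Residues start at 0, so the last letter, where [b] recurs, has residue -1. *)
Definition phi (x : 'I_p) : 'F_p := (nat_of_ord x)%:R%R.

Lemma natrFp_eq0 n : (n%:R == 0 :> 'F_p)%R = (p %| n)%N.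
Proof. by rewrite -(dvdn_pcharf (pchar_Fp p_pr)). Qed.

Lemma ltn_Fp (t : 'F_p) : (t < p)%N.
Proof. by rewrite -[X in (_ < X)%N](Fp_cast p_pr) ltn_ord. Qed.

Definition letter_of (t : 'F_p) : 'I_p := Ordinal (ltn_Fp t).

Lemma letter_ofK : cancel letter_of phi.
Proof. by move=> t; rewrite /phi natr_Zp. Qed.

Lemma phi_inj : injective phi.
Proof.
move=> x y /(congr1 val); rewrite /phi /= !val_Fp_nat // !modn_small //.
exact: val_inj.
Qed.

Lemma phiK : cancel phi letter_of.
Proof. by move=> x; apply: phi_inj; rewrite letter_ofK. Qed.

Lemma phi_ordS x : phi (ordS x) = (phi x + 1)%R.
Proof. by rewrite /phi /= Fp_nat_mod // -natr1. Qed.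

(** The sum x + n lies strictly between 0 and 2p, where the only multiple of p is p itself. *)
Lemma phi_eq_opp x n : (0 < n <= p)%N -> (phi x + n%:R == 0)%R = (x + n == p)%N.
Proof.
case/andP=> n0 np; rewrite /phi -natrD natrFp_eq0; apply/idP/eqP => [|->//].
have xp := ltn_ord x.
by case/dvdnP=> -[|[|k]]; rewrite ?mul0n ?mulSn ?addn0 => E; lia.
Qed.

Lemma Fp_expp (t : 'F_p) : (t ^+ p = t)%R.
Proof.
rewrite -[t]natr_Zp -natrX; apply: val_inj.
by rewrite /= !val_Fp_nat // fermat_little.
Qed.

(** A progression of p terms with nonzero difference meets each residue exactly once. *)
Lemma sum_arith_Fp (F : 'F_p -> 'F_p) (s t : 'F_p) : s != 0%R ->
  (\sum_(j < p) F (t + s *+ j) = \sum_k F k)%R.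
Proof.
move=> s0; rewrite [RHS](reindex (fun j : 'I_p => t + s * phi j)%R).
  by apply: eq_bigr => j _; rewrite /phi mulr_natr.
apply: onW_bij; exists (fun k : 'F_p => letter_of ((k - t) / s)%R) => [j|k].
  by rewrite addrAC subrr add0r mulrAC divff // mul1r phiK.
by rewrite letter_ofK mulrC divfK // addrC subrK.
Qed.

Lemma sum_const_Fp (c : 'F_p) : (\sum_(k : 'F_p) c = 0)%R.
Proof. by rewrite sumr_const card_Fp // -mulr_natr pchar_Fp_0 // mulr0. Qed.

Lemma sum_shift_Fp (F : 'F_p -> 'F_p) (s : 'F_p) :
  (\sum_k F (k + s) = \sum_k F k)%R.
Proof.
rewrite [RHS](reindex (fun k : 'F_p => k + s)%R) //.
by apply: onW_bij; exists (fun k => k - s)%R => k; rewrite ?addrK ?subrK.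
Qed.

Lemma sum_delta_Fp (s : 'F_p) : (\sum_(k : 'F_p) (k + s == 0)%:R = 1 :> 'F_p)%R.
Proof.
rewrite (sum_shift_Fp (fun k => (k == 0)%:R)%R) (bigD1 0%R) //=.
by rewrite big1 ?addr0 // => k /negPf ->.
Qed.

End PrimeField.

Definition ggs_vector (p : nat) (lambda : 'F_p) : 'rV['F_p]_(p.-1) :=
  (\row_(i < p.-1) (if i.+1 == p.-1 then lambda else 1))%R.

(** * The generators, their sections and exponent sums modulo p *)

Section Generators.
Variables (p : nat) (lambda : 'F_p).
Hypothesis p_pr : prime p.

Local Notation a := (ggs_a p).
Local Notation b := (ggs_b (ggs_vector lambda)).
Local Notation G := (ggs_group (ggs_vector lambda)).
Local Notation mu := (lambda - 1)%R.

Definition apow (t : 'F_p) : tree_aut p := a ^+ t.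

Lemma letter_a x : letter a x = ordS x.
Proof. exact: letter_eq. Qed.

Lemma section_a x : section a [:: x] = 1.
Proof. exact: section_eq. Qed.

Lemma section_aX n x : section (a ^+ n) [:: x] = 1.
Proof.
elim: n x => [|n IH] x; first by rewrite expg0 section1.
by rewrite expgSr sectionM section_a mulg1 letterE IH.
Qed.

Lemma letter_aX n x : phi (letter (a ^+ n) x) = (phi x + n%:R)%R.
Proof.
elim: n x => [|n IH] x; first by rewrite expg0 letter1 addr0.
by rewrite expgSr letterM IH letter_a phi_ordS // -addrA -[(n.+1)%:R%R]nat1r.
Qed.

Lemma expg_a_p : a ^+ p = 1.
Proof.
apply: tree_aut_eq1 => x; last by rewrite section_aX section1.
by apply: (phi_inj p_pr); rewrite letter_aX pchar_Fp_0 // addr0 letter1.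
Qed.

Lemma aX_mod n : a ^+ n = apow n%:R%R.
Proof.
rewrite /apow val_Fp_nat // [in LHS](divn_eq n p) expgnDr mulnC expgnA expg_a_p.
by rewrite expg1n mul1g.
Qed.

Lemma apowD s t : apow (s + t)%R = apow s * apow t.
Proof. by rewrite -[s]natr_Zp -[t]natr_Zp -natrD -!aX_mod expgnDr. Qed.

Lemma apow0 : apow 0%R = 1. Proof. exact: expg0. Qed.

Lemma apow1 : apow 1%R = a. Proof. by rewrite -(aX_mod 1) expg1. Qed.

Lemma apowN t : apow (- t)%R = (apow t)^-1.
Proof. by apply/esym/mulg1_eq; rewrite -apowD subrr. Qed.

Lemma apowX s n : apow s ^+ n = apow (s *+ n)%R.
Proof.
elim: n => [|n IH]; first by rewrite expg0 mulr0n.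
by rewrite expgSr IH mulrSr apowD.
Qed.

(** The sections of [b], indexed by the residue of the letter plus 1. Then [b] sits at index 0 and
    the power with exponent lambda at index -1, which makes cyclic shifts easy to follow. *)
Definition b_section (t : 'F_p) : tree_aut p :=
  (if t == 0 then b else apow (if t == -1 then lambda else 1))%R.

Lemma letter_b x : letter b x = x.
Proof. by []. Qed.

Lemma section_b x : section b [:: x] = b_section (phi x + 1)%R.
Proof.
apply: section_eq => w; have p2 := prime_gt1 p_pr; have xp := ltn_ord x.
rewrite letterE letter_b /b_section cat1s.
rewrite -[b ([:: x] ++ w)]/(x :: (if insub (val x) is Some i then
   (a ^+ (ggs_vector lambda ord0 i : 'F_p)) w else b w)); congr (_ :: _).
have -> : (phi x + 1 == 0)%R = (x + 1 == p)%N.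
  by rewrite -(@phi_eq_opp p p_pr) // (ltnW p2).
have -> : (phi x + 1 == -1)%R = (x + 2 == p)%N.
  by rewrite -(@phi_eq_opp p p_pr) // -subr_eq0 opprK -addrA.
case: insubP => [i /= xi vi|/= nx].
  have -> : (x + 1 == p)%N = false by apply/eqP; lia.
  have -> : (x + 2 == p)%N = (i.+1 == p.-1) by rewrite vi; apply/eqP/eqP; lia.
  by rewrite mxE.
suff -> : (x + 1 == p)%N by [].
by apply/eqP; lia.
Qed.

(** The sections of b^p are p-th powers of powers of a, hence trivial, except for b^p itself;
    induction on the word concludes. *)
Lemma expg_b_p : b ^+ p = 1.
Proof.
have b1 : st1 b by exact: letter_b.
apply: tree_aut_ext; elim=> [|x w IH]; first by rewrite tree_aut_nil.
rewrite -cat1s sectionE (sectionX _ (st1_word x b1)) section_b; congr (_ ++ _).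
  by rewrite st1_word //; apply: st1X.
by rewrite /b_section; case: ifP => // _; rewrite apowX -mulr_natr pchar_Fp_0 // mulr0.
Qed.

(* [gclass g s r]: some word in [a] and [b] representing [g] has exponent sums
   [s] and [r] modulo [p]. *)
Inductive gclass : tree_aut p -> 'F_p -> 'F_p -> Prop :=
| GClass1 : gclass 1 0%R 0%R
| GClassA g s r : gclass g s r -> gclass (a * g) (s + 1)%R r
| GClassB g s r : gclass g s r -> gclass (b * g) s (r + 1)%R.

Lemma gclassE g s r s' r' : gclass g s r -> s = s' -> r = r' -> gclass g s' r'.
Proof. by move=> gc <- <-. Qed.

Lemma gclassM g h s r s' r' : gclass g s r -> gclass h s' r' ->
  gclass (g * h) (s + s')%R (r + r')%R.
Proof.
move=> gc hc; elim: gc => [|{}g {}s {}r _ IH|{}g {}s {}r _ IH].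
- by rewrite mul1g !add0r.
- by rewrite -mulgA addrAC; apply: GClassA.
- by rewrite -mulgA [(_ + 1 + _)%R]addrAC; apply: GClassB.
Qed.

Lemma gclass_a : gclass a 1%R 0%R.
Proof. by rewrite -[a]mulg1 -[1%R]add0r; apply: GClassA; apply: GClass1. Qed.

Lemma gclass_b : gclass b 0%R 1%R.
Proof. by rewrite -[b]mulg1 -[1%R]add0r; apply: GClassB; apply: GClass1. Qed.

Lemma gclassX g s r n : gclass g s r -> gclass (g ^+ n) (s *+ n)%R (r *+ n)%R.
Proof.
move=> gc; elim: n => [|n IH]; first by rewrite expg0 !mulr0n; apply: GClass1.
by rewrite expgSr !mulrSr; apply: gclassM.
Qed.

Lemma gclass_apow t : gclass (apow t) t 0%R.
Proof.
by have := gclassX t gclass_a; rewrite mul0rn natr_Zp.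
Qed.

Lemma invg_pred (g : tree_aut p) : g ^+ p = 1 -> g^-1 = g ^+ p.-1.
Proof.
by move=> gp; apply: mulg1_eq; rewrite -expgS prednK // prime_gt0.
Qed.

(** As a^p = b^p = 1, inverses of generators are positive powers; this is why [gclass] has no
    constructor for inverses. *)
Lemma gclassV g s r : gclass g s r -> gclass g^-1 (- s)%R (- r)%R.
Proof.
have m1 : (p.-1%:R = -1 :> 'F_p)%R.
  by apply/eqP; rewrite -subr_eq0 opprK natr1 prednK ?prime_gt0 // pchar_Fp_0.
elim=> {g s r} [|g s r _ IH|g s r _ IH].
- by rewrite invg1 !oppr0; apply: GClass1.
- have := gclassM IH (gclassX p.-1 gclass_a).
  by rewrite -invg_pred ?expg_a_p // -invgM mul0rn m1 addr0 opprD.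
- have := gclassM IH (gclassX p.-1 gclass_b).
  by rewrite -invg_pred ?expg_b_p // -invgM mul0rn m1 addr0 opprD.
Qed.

Lemma gclass_G g : g \insub G -> exists s r, gclass g s r.
Proof.
move: g; apply: gen_ind => [|g h [s [r gc]] [s' [r' hc]]|_ [->|->]].
- by exists 0%R, 0%R; apply: GClass1.
- exists (s - s')%R, (r - r')%R; apply: gclassM => //; exact: gclassV.
- by exists 1%R, 0%R; apply: gclass_a.
- by exists 0%R, 1%R; apply: gclass_b.
Qed.

Lemma gclass_derived g : g \insub comm_subgroup G G -> gclass g 0%R 0%R.
Proof.
move: g; apply: gen_ind => [|g h gc hc|_ [g [h [Gg Gh ->]]]].
- exact: GClass1.
- by apply: gclassE (gclassM gc (gclassV hc)) _ _; rewrite subrr.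
have [s [r gc]] := gclass_G Gg; have [s' [r' hc]] := gclass_G Gh.
apply: gclassE (gclassM (gclassV gc) (gclassM (gclassV hc) (gclassM gc hc))) _ _;
  ring.
Qed.

Lemma gclass_letter g s r x : gclass g s r -> phi (letter g x) = (phi x + s)%R.
Proof.
elim=> [|{}g {}s {}r _ IH|{}g {}s {}r _ IH]; first by rewrite addr0.
- by rewrite letterM letter_a phi_ordS // IH addrA.
- by rewrite letterM letter_b IH.
Qed.

Lemma gclass_b_section t : gclass (b_section t)
  (1 - (t == 0)%:R + mu * (t == -1)%:R)%R (t == 0)%:R%R.
Proof.
rewrite /b_section; case: eqVneq => [->|t0].
  rewrite eq_sym oppr_eq0 oner_eq0 mulr0 addr0 subrr; exact: gclass_b.
rewrite subr0; apply: gclassE (gclass_apow _) _ (erefl _).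
by case: eqP => _ /=; rewrite  ?mulr1 ?mulr0 ?addr0 // addrC subrK.
Qed.

(* The conjugate of [b] whose section at [i] is [b] has at [k] a section of
   a-exponent [1 - (k == i) + (lambda - 1) * (k + 1 == i)]. *)
Lemma gclass_sections g s r : gclass g s r ->
  exists2 rv : 'F_p -> 'F_p, (\sum_k rv k = r)%R &
    forall x, gclass (section g [:: x])
      (r - rv (phi x) + mu * rv (phi x + 1))%R (rv (phi x)).
Proof.
elim=> [|{}g {}s {}r _ [rv rvE IH]|{}g {}s {}r gc [rv rvE IH]].
- exists (fun=> 0%R) => [|x]; first by rewrite big1.
  rewrite section1; apply: gclassE GClass1 _ _ => //; ring.
- by exists rv => // x; rewrite sectionM letterE section_a mul1g.
(* Since g moves the letter x to residue phi x + s, the new factor in the section at x is the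
   section of [b] there, which is [b] exactly when phi x + s + 1 = 0. *)
exists (fun k => rv k + (k + (s + 1) == 0)%:R)%R => [|x].
  by rewrite big_split /= rvE sum_delta_Fp.
rewrite sectionM letterE section_b (gclass_letter x gc).
apply: gclassE (gclassM (gclass_b_section _) (IH x)) _ _.
  rewrite -[(_ == -1)%R]subr_eq0 opprK.
  have -> : (phi x + s + 1 + 1 = phi x + 1 + (s + 1))%R by ring.
  rewrite [(phi x + s + 1)%R](_ : _ = phi x + (s + 1))%R; ring.
by rewrite addrC !addrA.
Qed.

(** * Elements of infinite order and torsion-freeness *)

Section TorsionFree.
Hypothesis lambda_neq2 : lambda != 2%:R%R.

(** The section of g^n at x is the product of the sections of g along the orbit of x, whose residues
    advance by s. *)
Lemma gclass_section_exp g s r n x : gclass g s r ->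
  exists2 rv : 'F_p -> 'F_p, (\sum_k rv k = r)%R &
    gclass (section (g ^+ n) [:: x])
      (\sum_(j < n) (r - rv (phi x + s *+ j) + mu * rv (phi x + s *+ j + 1)))%R
      (\sum_(j < n) rv (phi x + s *+ j))%R.
Proof.
move=> gc; have [rv rvE IH] := gclass_sections gc; exists rv => //.
elim: n => [|n IHn].
  by rewrite !big_ord0 expg0 section1; apply: GClass1.
rewrite expgS sectionM letterE !big_ord_recr /=.
rewrite -(gclass_letter x (gclassX n gc)).
apply: gclassE (gclassM (IH _) IHn) _ _; exact: addrC.
Qed.

(** Descent on m. As g rotates the first level by s, g^m = 1 forces p to divide m; a section of g^p
    then satisfies the same hypotheses and is killed by m / p. *)
Lemma gclass_infinite_order g s r m : gclass g s r -> s != 0%R -> r != 0%R ->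
  (0 < m)%N -> g ^+ m <> 1.
Proof.
have [n] := ubnP m; elim: n m g s r => // n IHn m g s r mn gc s0 r0 m0 gm.
pose x := letter_of p_pr 0%R.
have /dvdnP[m' mE] : (p %| m)%N.
  have := gclass_letter x (gclassX m gc).
  rewrite gm letter1 => /eqP; rewrite eq_sym -subr_eq0 addrAC subrr add0r.
  by rewrite -mulr_natr mulf_eq0 (negPf s0) natrFp_eq0.
have [rv rvE] := gclass_section_exp p x gc.
have -> : (\sum_(j < p) rv (phi x + s *+ j) = r)%R.
  by rewrite (sum_arith_Fp p_pr rv) // rvE.
(* Over the full cycle the constant r adds up to p r = 0, so the a-exponent is -r + mu r = (lambda -
   2) r. *)
rewrite (sum_arith_Fp p_pr (fun k => r - rv k + mu * rv (k + 1)))%R //.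
rewrite big_split /= sumrB sum_const_Fp // rvE -mulr_sumr sum_shift_Fp // rvE => hc.
have m'0 : (0 < m')%N by rewrite mE muln_gt0 in m0; case/andP: m0.
apply: (IHn m' _ _ _ _ hc _ r0 m'0).
- rewrite -ltnS (leq_trans _ mn) // ltnS mE -[X in (X < _)%N]muln1.
  by rewrite ltn_pmul2l // prime_gt1.
- rewrite (_ : (0 - r + mu * r = (lambda - 2%:R) * r)%R); last by ring.
  by rewrite mulf_neq0 // subr_eq0.
- rewrite -sectionX -?expgnA; first by rewrite mulnC -mE gm section1.
  rewrite letterE; congr [:: _]; apply: (phi_inj p_pr).
  by rewrite (gclass_letter x (gclassX p gc)) -mulr_natr pchar_Fp_0 // mulr0 addr0.
Qed.

(** Induction on the word acted upon: every section of g is again torsion, and is shown to have both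
    exponent sums zero. *)
Lemma gclass0_torsion_free g m : gclass g 0%R 0%R -> (0 < m)%N ->
  g ^+ m = 1 -> g = 1.
Proof.
move=> gc m0 gm; apply: tree_aut_ext => w.
elim: w g gc gm => [|x w IH] g gc gm; first by rewrite tree_aut_nil.
have g1 : st1 g.
  by move=> y; apply: (phi_inj p_pr); rewrite (gclass_letter y gc) addr0.
have gsm y : section g [:: y] ^+ m = 1.
  by rewrite -sectionX ?gm ?section1 // st1_word.
have [rv rvE gsc] := gclass_sections gc.
(* A torsion section cannot have both exponents nonzero, and its a-exponent is mu rv(k+1) -
   rv(k). *)
have rv_step k : (rv k = 0 \/ rv k = mu * rv (k + 1))%R.
  have := gsc (letter_of p_pr k); rewrite letter_ofK.
  case: (eqVneq (rv k) 0%R) => [|rk]; first by left.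
  case: (eqVneq (rv k) (mu * rv (k + 1))%R) => [|rmu]; first by right.
  move=> /gclass_infinite_order - /(_ m); case=> //.
  by rewrite sub0r addrC subr_eq0 eq_sym.
have rv0 k : rv k = 0%R.
  apply/eqP; apply/negP => /negP rk.
  (* One turn round the p letters gives rv(k) = mu^p rv(k), which is mu rv(k) by Fermat; with rv(k)
     nonzero this would mean lambda = 2. *)
  have rvn n : (rv k = mu ^+ n * rv (k + n%:R))%R.
    elim: n => [|n IHn]; first by rewrite addr0 mul1r.
    case: (rv_step (k + n%:R)%R) => E.
      by case/eqP: rk; rewrite IHn E mulr0.
    by rewrite IHn E mulrA -exprSr -addrA natr1.
  have := rvn p; rewrite pchar_Fp_0 // addr0 Fp_expp // -{1}[rv k]mul1r.
  move/(mulIf rk)/eqP; rewrite  -subr_eq0 opprB addrA subr_eq0 eq_sym.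
  by rewrite -(natrD _ 1 1) (negPf lambda_neq2).
rewrite cons_letterE g1 IH //; apply: gclassE (gsc x) _ _; rewrite !rv0 //; ring.
Qed.

End TorsionFree.

End Generators.

(** * Branching *)

Section Branching.
Variables (p : nat) (lambda : 'F_p).
Hypotheses (p_pr : prime p) (p_odd : odd p).
Hypotheses (lambda_neq1 : lambda != 1%R) (lambda_neq2 : lambda != 2%:R%R).

Local Notation a := (ggs_a p).
Local Notation b := (ggs_b (ggs_vector lambda)).
Local Notation G := (ggs_group (ggs_vector lambda)).
Local Notation G' := (comm_subgroup G G).
Local Notation mu := (lambda - 1)%R.

Lemma a_in_G : a \insub G. Proof. by apply: gen_mem; left. Qed.

Lemma b_in_G : b \insub G. Proof. by apply: gen_mem; right. Qed.

Lemma apow_in_G (t : 'F_p) : apow t \insub G. Proof. exact: subX a_in_G. Qed.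

Lemma gclass_in_G g s r : gclass lambda g s r -> g \insub G.
Proof.
elim=> [|{}g {}s {}r _ IH|{}g {}s {}r _ IH]; first exact: sub1.
- by apply: subM => //; apply: a_in_G.
- by apply: subM => //; apply: b_in_G.
Qed.

Lemma section_in_G g v : g \insub G -> section g v \insub G.
Proof.
elim: v g => [|x v IH] g Gg; first by rewrite section_nil.
rewrite -cat1s section_cat; apply: IH.
have [s [r /(gclass_sections p_pr) [rv _ /(_ x)]]] := gclass_G p_pr Gg.
exact: gclass_in_G.
Qed.

Lemma derived_st1 g : g \insub G' -> st1 g.
Proof.
move=> /(gclass_derived p_pr) gc x.
by apply: (phi_inj p_pr); rewrite (gclass_letter p_pr x gc) addr0.
Qed.

Lemma expp_st1 g : g \insub G -> st1 (g ^+ p).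
Proof.
move=> /(gclass_G p_pr) [s [r gc]] x; apply: (phi_inj p_pr).
rewrite (gclass_letter p_pr x (gclassX p gc)).
by rewrite -mulr_natr pchar_Fp_0 // mulr0 addr0.
Qed.

Lemma letter_apow (t : 'F_p) x : phi (letter (apow t) x) = (phi x + t)%R.
Proof. by rewrite /apow letter_aX // natr_Zp. Qed.

Lemma section_apow (t : 'F_p) x : section (apow t) [:: x] = 1.
Proof. exact: section_aX. Qed.

Lemma conj_apow_st1 g (t : 'F_p) : st1 g -> st1 (g ^ apow t).
Proof.
by move=> gs x; rewrite /conjg !letterM gs -letterM mulVg letter1.
Qed.

(** Conjugation by a power of a rotates the tuple of sections. *)
Lemma section_conj_apow g (t : 'F_p) x : st1 g ->
  section (g ^ apow t) [:: x] = section g [:: letter (apow t) x].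
Proof.
move=> gs; rewrite /conjg -apowN // !sectionM !section_apow mulg1.
by rewrite !letterE section_apow mul1g.
Qed.

(* The shift [-1 - t] makes the section at the letter [t] equal to [b]. *)
Definition b_at (t : 'F_p) : tree_aut p := b ^ apow (-1 - t)%R.

Lemma b_at_in_G t : b_at t \insub G.
Proof. by apply: subJ; [exact: b_in_G | exact: apow_in_G]. Qed.

Lemma b_at_st1 t : st1 (b_at t).
Proof. exact/conj_apow_st1/letter_b. Qed.

Lemma section_b_at t x : section (b_at t) [:: x] = b_section lambda (phi x - t)%R.
Proof.
rewrite section_conj_apow; last exact: letter_b.
by rewrite section_b // letter_apow; congr b_section; ring.
Qed.

Lemma b_at_div t u : b_at t / b_at u \insub G'.
Proof.
have -> : b_at t / b_at u =
    ([~ b, apow (-1 - t)%R] / [~ b, apow (-1 - u)%R]) ^ b^-1.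
  by rewrite /b_at /commg; set x := apow _; set y := apow _;
    rewrite /conjg !gnorm.
apply: (derived_normal (subV b_in_G)).
by apply: subF; apply: comm_mem; [exact: b_in_G | exact: apow_in_G
  | exact: b_in_G | exact: apow_in_G].
Qed.

Lemma natrFp_neq0 n : (0 < n < p)%N -> (n%:R != 0 :> 'F_p)%R.
Proof. by case/andP=> n0 np; rewrite natrFp_eq0 // gtnNdvd. Qed.

Lemma Fp_neq0_2 : (2%:R != 0 :> 'F_p)%R.
Proof. by apply: natrFp_neq0; have := prime_gt1 p_pr; case: p p_odd => [|[|[|]]]. Qed.

Lemma b_section0 : b_section lambda 0%R = b.
Proof. by rewrite /b_section eqxx. Qed.

Lemma b_sectionN1 : b_section lambda (-1)%R = apow lambda.
Proof. by rewrite /b_section oppr_eq0 oner_eq0 eqxx. Qed.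

Lemma b_section_a t : t != 0%R -> t != (-1)%R -> b_section lambda t = a.
Proof. by rewrite /b_section => /negPf -> /negPf ->; apply: apow1. Qed.

Lemma b_section1 : b_section lambda 1%R = a.
Proof.
by apply: b_section_a; rewrite ?oner_eq0 // -subr_eq0 opprK -(natrD _ 1 1) Fp_neq0_2.
Qed.

Lemma mu_neq0 : mu != 0%R. Proof. by rewrite subr_eq0. Qed.

Lemma apow_mu_exp : exists n, apow mu ^+ n = a.
Proof.
exists (mu^-1 : 'F_p)%R; rewrite apowX // -mulr_natr natr_Zp divff ?mu_neq0 //.
Qed.

(** Quotients of conjugates of [b] lie in G'. Suitable ones have at x the sections a^mu and b a^-1,
    and a^mu generates the powers of a because mu is nonzero. *)
Lemma derived_section_onto x g : g \insub G ->
  exists2 h, h \insub G' & section h [:: x] = g.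
Proof.
have sE t u : section (b_at t / b_at u) [:: x] =
    b_section lambda (phi x - t)%R / b_section lambda (phi x - u)%R.
  rewrite sec_st1M ?sec_st1V ?section_b_at //; first exact: b_at_st1.
  by apply: st1V; apply: b_at_st1.
have sM h k : h \insub G' -> k \insub G' ->
    section (h / k) [:: x] = section h [:: x] / section k [:: x].
  move=> /derived_st1 hs /derived_st1 ks.
  by rewrite sec_st1M ?sec_st1V //; apply: st1V.
have [ha Gha haE] : exists2 h, h \insub G' & section h [:: x] = a.
  have [n nE] := apow_mu_exp.
  (* At x the two conjugates have sections a^lambda and a. *)
  set h := b_at (phi x + 1)%R / b_at (phi x - 1)%R.
  have Gh : h \insub G' by apply: b_at_div.
  exists (h ^+ n); first exact: subX.
  rewrite sectionX; last exact/st1_word/derived_st1.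
  rewrite sE opprD addrA subrr sub0r b_sectionN1 opprB addrCA subrr addr0 b_section1.
  by rewrite -(apow1 p_pr) -apowN // -apowD.
move: g; apply: gen_ind => [|g k [h Gh <-] [l Gl <-]|_ [->|->]].
- by exists 1; [exact: sub1 | exact: section1].
- by exists (h / l); [exact: subF | rewrite sM].
- by exists ha.
(* Here the section at x is b a^-1; multiplying by [ha] leaves b. *)
set h := b_at (phi x) / b_at (phi x - 1)%R.
have Gh : h \insub G' by apply: b_at_div.
exists (h / ha^-1); first by apply: subF => //; apply: subV.
rewrite sM //; last exact: subV.
rewrite sec_st1V ?haE; last exact: derived_st1.
by rewrite sE subrr b_section0 opprB addrCA subrr addr0 b_section1 !gnorm.
Qed.

(** * G' contains the copies of itself below all vertices *)

Definition plant_preimage (v : word p) (K : subgroup (tree_aut p)) :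
  subgroup (tree_aut p).
Proof.
apply: (@Subgroup _ [set h | plant v h \insub K]); apply: group_closedP.
- by rewrite /mkset gmulf1; apply: sub1.
- by move=> g h; rewrite /mkset gmulfF; apply: subF.
Defined.

Lemma plant_preimageE v K h :
  (h \insub plant_preimage v K) = (plant v h \insub K).
Proof. by []. Qed.

Lemma derived_plant1_conj x y h :
  plant1 x h \insub G' -> plant1 y h \insub G'.
Proof.
move=> Gh; have gy : apow (phi x - phi y)%R [:: y] = [:: x].
  rewrite letterE; congr [:: _]; apply: (phi_inj p_pr).
  by rewrite letter_apow addrC subrK.
rewrite -[plant1 y h]/(plant [:: y] h).
have := plant_conj h gy; rewrite section_apow conjg1 => <-.
by apply: derived_normal => //; apply: apow_in_G.
Qed.

Lemma commg_apow (s t : 'F_p) : [~ apow s, apow t] = 1.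
Proof. by apply/eqP/commgP/commuteX2. Qed.

Lemma section_commg_b_at t u x : section [~ b_at t, b_at u] [:: x] =
  [~ b_section lambda (phi x - t)%R, b_section lambda (phi x - u)%R].
Proof. by rewrite sec_st1R ?section_b_at //; apply: b_at_st1. Qed.

(** For lambda = 0, the conjugates [b_at 0] and [b_at 1] have commuting sections at every letter but
    the one of residue 1, where the sections are a and b. At residue 0 this uses a^lambda = 1. *)
Lemma branch_lambda0 : lambda = 0%R ->
  exists x, plant1 x [~ a, b] \insub G'.
Proof.
move=> l0; exists (letter_of p_pr 1%R).
suff <- : [~ b_at 0%R, b_at 1%R] = plant1 (letter_of p_pr 1%R) [~ a, b].
  by apply: comm_mem; apply: b_at_in_G.
apply: tree_aut_eq1 => x; first exact/st1R/b_at_st1/b_at_st1.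
rewrite section_commg_b_at section_plant1 subr0 -(inj_eq (phi_inj p_pr)) letter_ofK.
case: eqVneq => [->|x1]; first by rewrite subrr b_section0 b_section1.
have [->|x0] := eqVneq (phi x) 0%R.
  by rewrite sub0r b_sectionN1 l0 apow0 commg1.
rewrite [b_section _ (phi x - 1)%R]b_section_a ?subr_eq0 //; last first.
  by rewrite -subr_eq0 opprK subrK.
by rewrite /b_section (negPf x0) -(apow1 p_pr) commg_apow.
Qed.

(** The section of [b_at u / b_at (u + 1)] at the letter of residue u + t. It is trivial unless t is
    -1, 0 or 1. *)
Definition b_quot (t : 'F_p) : tree_aut p :=
  b_section lambda t / b_section lambda (t - 1)%R.

Lemma b_quot_eq1 t : t != (-1)%R -> t != 0%R -> t != 1%R -> b_quot t = 1.
Proof.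
move=> tN t0 t1; rewrite /b_quot !b_section_a ?mulgV // ?subr_eq0 //.
by rewrite -subr_eq0 opprK subrK.
Qed.

Lemma b_quotN1 : b_quot (-1)%R = apow mu.
Proof.
rewrite /b_quot b_sectionN1 b_section_a ?apowD ?apowN ?apow1 //.
  by rewrite -opprD oppr_eq0 -(natrD _ 1 1) Fp_neq0_2.
by rewrite -subr_eq0 opprK subrK oppr_eq0 oner_eq0.
Qed.

Lemma b_quot1 : b_quot 1%R = a / b.
Proof. by rewrite /b_quot b_section1 subrr b_section0. Qed.

(** Each g in G is the section at x of some k in G', and conjugating a copy below x by k conjugates
    its content by g. *)
Lemma plant_preimage_normal x g :
  g \insub G -> normalizes (plant_preimage [:: x] G') g.
Proof.
move=> Gg h hG; have [k Gk kE] := derived_section_onto x Gg.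
have kx : k [:: x] = [:: x] by apply/st1_word/derived_st1.
have := plant_conj h kx; rewrite kE plant_preimageE => <-.
by apply: subJ.
Qed.

(** Two quotients of consecutive conjugates of [b] are chosen so that their nontrivial sections
    overlap at a single letter; their commutator is then a copy of [a / b, a^mu] below it. *)
Lemma branch_lambda_neq0 : lambda != 0%R ->
  exists x, plant1 x [~ a, b] \insub G'.
Proof.
(* For p = 3, lambda would have to be 0, 1 or 2. *)
move=> l0; have p_gt4 : (4 < p)%N.
  have p_lt3 := odd_prime_gt2 p_odd p_pr.
  have [p4|//] := leqP p 4.
  have p3 : p = 3%N by case: p p_odd p_lt3 p4 => [|[|[|[|[|]]]]].
  have := ltn_Fp p_pr lambda; rewrite [X in (_ < X)%N]p3 => l3.
  move: l0 lambda_neq1 lambda_neq2; rewrite -[lambda]natr_Zp.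
  by case: (nat_of_ord lambda) l3 => [|[|[|]]]; rewrite ?eqxx.
set x1 := letter_of p_pr 1%R; exists x1.
pose g t := b_at t / b_at (t + 1)%R.
have g1 t : st1 (g t) by apply: st1M; [|apply: st1V]; apply: b_at_st1.
have Gg t : g t \insub G by apply: subF; apply: b_at_in_G.
have gE t x : section (g t) [:: x] = b_quot (phi x - t)%R.
  rewrite sec_st1M ?sec_st1V ?section_b_at //; do ?[apply: st1V | apply: b_at_st1].
  by rewrite /b_quot opprD addrA.
have n0 n : (0 < n < 5)%N -> (n%:R != 0 :> 'F_p)%R.
  by case/andP=> n0 n5; apply: natrFp_neq0; rewrite n0 (leq_trans _ p_gt4).
(* The nontrivial sections of [g 0] are at -1, 0, 1 and those of [g 2] at 1, 2, 3; as p is at least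
   5, only the residue 1 is common. *)
have E : [~ g 0%R, g 2%:R%R] = plant1 x1 [~ a / b, apow mu].
  apply: tree_aut_eq1 => x; first exact: st1R.
  rewrite sec_st1R // !gE section_plant1 subr0 -(inj_eq (phi_inj p_pr)) letter_ofK.
  case: eqVneq => [->|x1n].
    by rewrite b_quot1 -b_quotN1; congr [~ _, b_quot _]; ring.
  have [E|xN] := eqVneq (phi x) (-1)%R.
    rewrite [b_quot (phi x - _)%R]b_quot_eq1 ?commg1 // E.
    - by rewrite -subr_eq0 [X in X != _](_ : _ = - 2%:R)%R ?oppr_eq0 ?n0 //; ring.
    - by rewrite [X in X != _](_ : _ = - 3%:R)%R ?oppr_eq0 ?n0 //; ring.
    - by rewrite -subr_eq0 [X in X != _](_ : _ = - 4%:R)%R ?oppr_eq0 ?n0 //; ring.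
  have [E|xz] := eqVneq (phi x) 0%R.
    rewrite [b_quot (phi x - _)%R]b_quot_eq1 ?commg1 // E.
    - by rewrite -subr_eq0 [X in X != _](_ : _ = - 1%:R)%R ?oppr_eq0 ?n0 //; ring.
    - by rewrite [X in X != _](_ : _ = - 2%:R)%R ?oppr_eq0 ?n0 //; ring.
    - by rewrite -subr_eq0 [X in X != _](_ : _ = - 3%:R)%R ?oppr_eq0 ?n0 //; ring.
  by rewrite b_quot_eq1 // comm1g.
pose N := plant_preimage [:: x1] G'.
have NG h : h \insub G -> normalizes N h by apply: plant_preimage_normal.
have Gab : a / b \insub G by apply: subF; [exact: a_in_G | exact: b_in_G].
have N1 : [~ a / b, apow mu] \insub N.
  by rewrite plant_preimageE /= -E; apply: comm_mem.
(* Modulo [N], what commutes with a^mu commutes with its power a. *)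
have N2 : [~ a / b, a] \insub N.
  apply: (commg_gen_sub NG (S := [set apow mu])) => [_ ->|_ ->|] //.
    exact: apow_in_G.
  by have [n <-] := apow_mu_exp; apply: subX; apply: gen_mem.
(* Modulo [N], a commutes with itself and with a / b, and these two generate b. *)
suff : [~ a, b] \insub N by [].
apply: (commg_gen_sub NG (S := [set a; a / b])) => [_ [->|->]|_ [->|->]|] //.
- exact: a_in_G.
- by rewrite commgg; apply: sub1.
- exact: commg_sym_sub.
have bE : b = (a / b)^-1 * a by rewrite invgF mulgVK.
rewrite [X in X \insub _]bE.
by apply: subM; [apply: subV|]; apply: gen_mem; [right | left].
Qed.

(** The elements whose copy below x lies in G' form a subgroup normalized by G and containing
    [a, b], hence containing G'. Conjugation by powers of a reaches the other letters, and induction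
    the deeper vertices. *)
Lemma derived_plant v h : h \insub G' -> plant v h \insub G'.
Proof.
have [x Gx] : exists x, plant1 x [~ a, b] \insub G'.
  have [|] := eqVneq lambda 0%R; [exact: branch_lambda0 | exact: branch_lambda_neq0].
have plant1G k y : k \insub G' -> plant1 y k \insub G'.
  move=> Gk; apply: (@derived_plant1_conj x).
  suff : k \insub plant_preimage [:: x] G' by [].
  apply: (@derived_gen2_sub _ G _ _ a b) => // g; exact: plant_preimage_normal.
by elim: v => // y v IH /IH; rewrite plant_cons; apply: plant1G.
Qed.

(** An element of G that moves the tail of u correctly is the section at x of an element of G',
    which fixes x; a power of a then corrects the first letter. *)
Lemma level_transitive u v : size u = size v ->
  exists2 g, g \insub G & g u = v.
Proof.
elim: u v => [|x u IH] [|y v] // => [_|[/IH [g Gg <-]]].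
  by exists 1; [exact: sub1 | rewrite oneE].
have [h Gh hE] := derived_section_onto x Gg.
exists (apow (phi y - phi x)%R * h).
  by apply: subM; [exact: apow_in_G | exact: derived_sub].
rewrite mulE cons_letterE hE (derived_st1 Gh) cons_letterE section_apow.
congr (_ :: _).
by apply: (phi_inj p_pr); rewrite letter_apow addrC subrK.
Qed.

(** * Subgroups normalized by G *)

Local Notation L := (comm_subgroup G' G).

(** Commutators with an element k moving a vertex w put copies of commutators of G' into K below w.
    Passing to a child of w replaces one factor G' by G, and transitivity spreads the result over
    the level. *)
Lemma normal_contains_level (K : subgroup (tree_aut p)) k :
  (forall g, g \insub G -> normalizes K g) -> k \insub K -> k != 1 ->
  exists n, forall v h, size v = n -> h \insub L -> plant v h \insub K.
Proof.
move=> KG Kk k1.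
have [w kw] : exists w, k w != w.
  apply: contrapT => /forallNP kE; case/eqP: k1; apply: tree_aut_ext => w.
  by apply: contrapT => /eqP/kE.
have Kw x y : x \insub G' -> y \insub G' -> plant w [~ x, y] \insub K.
  move=> Gx Gy; rewrite gmulfR.
  have GX := derived_sub (derived_plant w (subV Gx)).
  have GY := derived_sub (derived_plant w Gy).
  (* Z is a copy below the inverse image of w under k, which differs from w. So Z commutes with
     every copy below w, and [[X^-1, k], Y] = [X Z, Y] = [X, Y]. *)
  set X := plant w x; set Y := plant w y; set Z := (X^-1) ^ k.
  have ZC h : commute Z (plant w h).
    rewrite /Z -gmulfV; have kk : k (k^-1 w) = w by rewrite -mulE mulgV oneE.
    rewrite (plant_conj _ kk); apply: plant_commute; first exact: tree_aut_size.
    by apply: contra_neq kw => E; rewrite -{1}E kk.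
  have -> : [~ X, Y] = [~ [~ X^-1, k], Y].
    rewrite [[~ X^-1, k]]commgEl invgK -/Z commgMl.
    have /eqP -> : [~ Z, Y] == 1 by apply/commgP; apply: ZC.
    rewrite mulg1; apply/esym/conjg_fixP/commgP/commute_sym.
    by rewrite -gmulfR; apply: ZC.
  have XkK : [~ X^-1, k] \insub K.
    rewrite commgEr; apply: subM => //; apply: KG; last exact: subV.
    by rewrite -gmulfV.
  by rewrite commgEl; apply: subM; [apply: subV | apply: KG].
have p_gt0 := prime_gt0 p_pr; pose z : 'I_p := Ordinal p_gt0.
(* Let x in G' have section g at z. Then the copy of [g, y] below z is the commutator of x with the
   copy of y, both in G', so the previous step applies. *)
have Kwz h : h \insub L -> plant (w ++ [:: z]) h \insub K.
  move=> Lh; suff : h \insub plant_preimage (w ++ [:: z]) K by [].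
  apply: comm_min Lh => y g Gy Gg.
  apply: commg_sym_sub; rewrite plant_preimageE plant_cat.
  have [x Gx <-] := derived_section_onto z Gg.
  have zx : x [:: z] = [:: z] by apply/st1_word/derived_st1.
  have -> : plant [:: z] [~ section x [:: z], y] = [~ x, plant [:: z] y].
    by rewrite !commgEr gmulfM -gmulfV (plant_conj _ zx).
  by apply: Kw => //; apply: derived_plant.
exists (size (w ++ [:: z])) => v h vE Lh.
have [g Gg gv] := level_transitive vE.
have Gs : section g v \insub G by apply: section_in_G.
rewrite -[h](conjgKV (section g v)) -(plant_conj _ gv); apply: KG => //.
apply: Kwz; apply: comm_normal Lh; first exact: (derived_normal (subV Gs)).
exact: (normalizes_self (subV Gs)).
Qed.

Lemma exponent_derived g : g \insub G -> g ^+ p \insub G'.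
Proof.
apply: (@exponent_modulo _ G G').
- exact: derived_normal.
- exact: comm_mem.
- by move=> _ [->|->]; rewrite ?expg_a_p ?expg_b_p //; split;
    [exact: a_in_G | exact: sub1 | exact: b_in_G | exact: sub1].
Qed.

(** The group G / gamma_3(G) has exponent dividing p^2, and each level costs one more factor p: g^p
    fixes the first level, and its sections are treated by induction. *)
Lemma exponent_level n (K : subgroup (tree_aut p)) :
  (forall v h, size v = n -> h \insub L -> plant v h \insub K) ->
  forall g, g \insub G -> g ^+ (p ^ n.+2) \insub K.
Proof.
elim: n K => [|n IH] K KL g Gg.
  apply: (KL [::]) => //; rewrite expnS expn1.
  exact: (exponent_lower_central exponent_derived).
have g1 := expp_st1 Gg.
rewrite expnS expgnA; apply: st1_sub => [|x]; first exact: st1X.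
rewrite sectionX; last exact: st1_word.
suff : section (g ^+ p) [:: x] ^+ (p ^ n.+2) \insub plant_preimage [:: x] K by [].
apply: IH => [v h vn Lh|]; last by apply: section_in_G; apply: subX.
by rewrite plant_preimageE; apply: (KL (x :: v)); rewrite //= vn.
Qed.

Lemma normal_exponent (K : subgroup (tree_aut p)) k :
  (forall g, g \insub G -> normalizes K g) -> k \insub K -> k != 1 ->
  exists n, forall g, g \insub G -> g ^+ (p ^ n) \insub K.
Proof.
move=> KG Kk /(normal_contains_level KG Kk) [n KL].
by exists n.+2; apply: exponent_level.
Qed.

End Branching.

(** * Finite quotients and profinite completions *)

Section FiniteGroup.

(** An alias of [Q] that records an enumeration, so that it can carry a [finGroupType] structure and
    the theorems of Lagrange and Cauchy apply. *)
Definition fin_copy (Q : groupType) (s : seq Q) (sQ : forall x, x \in s) : Type :=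
  Q.

Variables (Q : groupType) (s : seq Q) (sQ : forall x, x \in s).

HB.instance Definition _ := Group.on (fin_copy sQ).

Lemma fin_copy_pcan :
  cancel (fun x : fin_copy sQ => index x s) (nth (1 : fin_copy sQ) s).
Proof. by move=> x; apply: nth_index. Qed.

HB.instance Definition _ :=
  Countable.copy (fin_copy sQ) (can_type fin_copy_pcan).

Lemma fin_copy_enum : Finite.axiom (undup s : seq (fin_copy sQ)).
Proof.
by move=> x; rewrite count_uniq_mem ?undup_uniq // mem_undup (sQ x).
Qed.

HB.instance Definition _ := isFinite.Build (fin_copy sQ) fin_copy_enum.

End FiniteGroup.

Lemma finite_group_exponent (Q : groupType) : finite_set [set: Q] ->
  exists2 k, (0 < k)%N & forall x : Q, x ^+ k = 1.
Proof.
move=> /finite_seqP[s sE]; have sQ (x : Q) : x \in s.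
  by have : [set: Q] x by []; rewrite sE.
exists #|[set: fin_copy sQ]%SET| => [|x].
  exact: (cardG_gt0 [set: fin_copy sQ]%G).
by apply: (@expg_cardG _ [set: fin_copy sQ]%G x); rewrite finset.in_setT.
Qed.

Lemma card_finType (T : finType) : ([set: T] #= `I_#|T|)%card.
Proof.
apply/card_set_bijP; exists (fun x => enum_rank x : nat); split.
- by move=> x _ /=; apply: ltn_ord.
- by move=> x y _ _ /val_inj /enum_rank_inj.
- by move=> i /= iT; exists (enum_val (Ordinal iT)) => //; rewrite enum_valK.
Qed.

(** By Cauchy, a prime q dividing the order is the order of some element, hence equals p. *)
Lemma finite_p_group (Q : groupType) p : prime p -> finite_set [set: Q] ->
  (forall x : Q, exists j, x ^+ (p ^ j) = 1) ->
  exists n, ([set: Q] #= `I_(p ^ n))%card.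
Proof.
move=> p_pr /finite_seqP[s sE] Qp; have sQ (x : Q) : x \in s.
  by have : [set: Q] x by []; rewrite sE.
pose T : finGroupType := fin_copy sQ.
suff /p_natP[n nE] : p.-nat #|[set: T]%G|.
  by exists n; rewrite -nE cardsT; apply: (card_finType T).
apply/pnatP => [|q q_pr /(Cauchy q_pr)[x _ xq]]; first exact: cardG_gt0.
have [j xj] := Qp x; have : (q %| p ^ j)%N by rewrite -xq order_dvdn; apply/eqP.
by rewrite Euclid_dvdX // dvdn_prime2 // => /andP[].
Qed.

(** * Normal subgroups of finite index *)

Section FiniteIndex.
Variable G : groupType.
Implicit Types (H : subgroup G) (M N : finite_quotient_kernel G).

Lemma lcosets_eqP H (x y : G) :
  \pi_(lcosets H) x = \pi_(lcosets H) y <-> x^-1 * y \insub H.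
Proof.
split=> [/(@eqmodP _ (lcoset_equiv H) x y)/set_mem //|Hxy].
by apply/(@eqmodP _ (lcoset_equiv H) x y)/mem_set.
Qed.

Lemma finite_index_inj H T (f : G -> T) (B : set T) : finite_set B ->
  (forall x, B (f x)) -> (forall x y, f x = f y -> x^-1 * y \insub H) ->
  finite_index H.
Proof.
move=> Bfin fB fH; rewrite /finite_index.
have -> : [set: lcosets H] = (fun q : lcosets H => f (repr q)) @^-1` B.
  by apply/seteqP; split=> // q _; apply: fB.
apply: finite_preimage => // q r _ _ /fH/lcosets_eqP.
by rewrite !reprK.
Qed.

Lemma fqk_full : exists N, forall x, x \insub N.
Proof.
have T1 : [set: G] 1 by [].
have TF x y : [set: G] x -> [set: G] y -> [set: G] (x / y) by [].
pose H := Subgroup (group_closedP T1 TF).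
have HJ x y : (H : set G) x -> (H : set G) (x ^ y) by [].
have Hfin : finite_index (NormalSubgroup HJ).
  by apply: (@finite_index_inj _ _ (fun=> tt) setT) => //; apply: finite_finset.
by exists (FiniteQuotientKernel Hfin).
Qed.

(** Closure under intersection makes the kernels a directed system, so finitely many coordinates of
    the completion are controlled by one. *)
Lemma fqk_meet N M : exists K : finite_quotient_kernel G,
  forall x, x \insub K <-> x \insub N /\ x \insub M.
Proof.
pose S := [set x | x \insub N /\ x \insub M].
have S1 : S 1 by split; apply: sub1.
have SF x y : S x -> S y -> S (x / y).
  by move=> [Nx Mx] [Ny My]; split; apply: subF.
pose H := Subgroup (group_closedP S1 SF).
have HJ x y : (H : set G) x -> (H : set G) (x ^ y).
  by move=> [Nx Mx]; split; apply: normal_conj.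
have Hfin : finite_index (NormalSubgroup HJ).
  apply: (@finite_index_inj _ _ (fun x => (\pi_(lcosets N) x, \pi_(lcosets M) x))
    ([set: lcosets N] `*` [set: lcosets M])) => //.
    by apply: finite_setX; apply: fqk_finite.
  by move=> x y [/lcosets_eqP Nxy /lcosets_eqP Mxy].
by exists (FiniteQuotientKernel Hfin).
Qed.

End FiniteIndex.

Lemma quotient_piX (G : groupType) (N : normal_subgroup G) (x : G) n :
  \pi_(quotient N) (x ^+ n) = \pi_(quotient N) x ^+ n.
Proof.
elim: n => [|n IH]; first by rewrite !expg0.
by rewrite !expgS -IH; apply/esym/quotient_mulE.
Qed.

(** * The topology of the profinite completion *)

Section Completion.
Variable G : groupType.
Implicit Types (M N : finite_quotient_kernel G) (u v : profinite_completion G).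

Lemma quotient_product_nbhs (f : quotient_product G) N :
  nbhs f [set g : quotient_product G | g N = f N].
Proof.
have cf := @proj_continuous _ (fun N => discrete_topology (quotient N)) N f.
apply: (cf [set f N]); apply: open_nbhs_nbhs; split=> //.
exact: discrete_open.
Qed.

Lemma completion_nbhs_comp v N :
  nbhs v [set u | completion_comp u N = completion_comp v N].
Proof.
have cv := @initial_continuous (profinite_completion G) (quotient_product G) val v.
exact: cv _ (quotient_product_nbhs (val v) N).
Qed.

(** The sets fixing one component generate a filter, by directedness of the kernels. It converges to
    v in every coordinate, hence in the product, so it refines every neighbourhood. *)
Lemma completion_nbhsP v (A : set (profinite_completion G)) : nbhs v A ->
  exists N, forall u, completion_comp u N = completion_comp v N -> A u.
Proof.
pose B N := [set u | completion_comp u N = completion_comp v N].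
pose F := filter_from [set: finite_quotient_kernel G] B.
have FF : Filter F.
  apply: filter_from_filter; first by have [N _] := fqk_full G; exists N.
  move=> N M _ _; have [K KNM] := fqk_meet N M; exists K => // u uK.
  by split; rewrite /B /mkset -[LHS](@completion_compP _ u K)
    -?[RHS](@completion_compP _ v K) ?uK // => x /KNM[].
have Fv : (val : profinite_completion G -> quotient_product G) @ F --> val v.
  apply/(@cvg_sup (quotient_product G)) => N U [_ [[W _ <-]] Wv WU].
  by exists N => // u uN; apply: WU; rewrite /= [val u N]uN.
case=> _ [[W oW <-] Wv WA]; have [N _ NW] : F (val @^-1` W).
  by apply: Fv; apply: open_nbhs_nbhs.
by exists N => u uN; apply: WA; apply: NW.
Qed.

Lemma completion_group : topological_group (profinite_completion G).
Proof.
split=> [[u v]|u] A /completion_nbhsP[N NA].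
  exists ([set w | completion_comp w N = completion_comp u N],
          [set w | completion_comp w N = completion_comp v N]).
    by split; apply: completion_nbhs_comp.
  move=> [x y] /= [xu yv]; apply: NA.
  by rewrite /completion_comp /= -!/(completion_comp _ _) xu yv.
apply: filterS (completion_nbhs_comp u N) => w wu; apply: NA.
by rewrite /completion_comp /= -!/(completion_comp _ _) wu.
Qed.

Lemma completion_hausdorff : hausdorff_space (profinite_completion G).
Proof.
move=> u v uv; apply: completion_comp_inj => N.
have [w [/= <- //]] := uv _ _ (completion_nbhs_comp u N) (completion_nbhs_comp v N).
Qed.

Lemma completion_totally_disconnected :
  totally_disconnected [set: profinite_completion G].
Proof.
apply: zero_dimension_totally_disconnected => u v uv.
have [N Nuv] : exists N, completion_comp v N <> completion_comp u N.
  apply/existsNP => E; case/eqP: uv; apply: completion_comp_inj => N.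
  by rewrite E.
exists [set w | completion_comp w N = completion_comp u N]; split=> //; split.
  rewrite openE => w /= wu; rewrite /interior -wu; exact: completion_nbhs_comp.
rewrite -openC openE => w /= wu.
by apply: filterS (completion_nbhs_comp w N) => x /= ->.
Qed.

Import ArrowAsProduct.

(** Coherent families form a closed subset of a product of finite discrete spaces, which is compact
    by Tychonoff. *)
Lemma completion_compact : compact [set: profinite_completion G].
Proof.
have Pc : compact [set: quotient_product G].
  have := @tychonoff _ (fun N => discrete_topology (quotient N))
    (fun N => setT).
  rewrite (_ : [set f | _] = [set: quotient_product G]); last first.
    by apply/seteqP; split.
  apply=> N; apply: finite_compact; exact: fqk_finite.
have Cc : compact (@coherent G).
  apply: (subclosed_compact _ Pc) => // f fcl N M NM.
  have [g [/(_ N M NM) gc [/= <- <-]]] := fcl _ (filterI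
    (quotient_product_nbhs f N) (quotient_product_nbhs f M)).
  exact: gc.
(* Compactness passes to the subtype by pushing the filter forward along [val] and lifting a cluster
   point. *)
move=> F PF _; pose vF := (val : profinite_completion G -> quotient_product G) @ F.
have vFC : vF (@coherent G).
  apply: (@filterS _ F _ setT) => [u _|]; last exact: filterT.
  exact: set_mem (valP u).
have [f [fC fcl]] := Cc vF _ vFC.
exists (exist _ f (mem_set fC)); split=> // A B FA [_ [[W oW <-] Wf WB]].
have vFA : vF ((val : profinite_completion G -> quotient_product G) @` A).
  by apply: (@filterS _ F _ A) FA => u Au; exists u.
have [_ [[u Au <-] Wu]] := fcl _ _ vFA (open_nbhs_nbhs (conj oW Wf)).
by exists u; split=> //; apply: WB.
Qed.

(** An open normal subgroup contains the kernel of the projection to some G / N. A component in G /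
    N is the class of an element of G, so it has p-power order, and the finite quotient is a
    p-group. *)
Lemma completion_pro_p p : prime p ->
  (forall N (x : G), exists j, x ^+ (p ^ j) \insub N) ->
  pro_p_group p (profinite_completion G).
Proof.
move=> p_pr Gp; split.
  split; [exact: completion_group | exact: completion_compact
    | exact: completion_hausdorff | exact: completion_totally_disconnected].
move=> H oH; have [N NH] : exists N, forall u,
    completion_comp u N = 1 -> u \insub H.
  by apply: (@completion_nbhsP 1); apply: open_nbhs_nbhs; split=> //; apply: sub1.
have Hfin : finite_index H.
  apply: (@finite_index_inj _ H (quotient N)
    (fun u : profinite_completion G => completion_comp u N) setT) => //.
    exact: fqk_finite.
  move=> u v uv; apply: NH.
  have -> : completion_comp (u^-1 * v) N =
      (completion_comp u N)^-1 * completion_comp v N by [].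
  by rewrite uv mulVg.
apply: (@finite_p_group (quotient H) p p_pr Hfin) => q.
rewrite -[q]reprK; set u := repr q.
have [j Nj] := Gp N (repr (completion_comp u N)); exists j.
rewrite -quotient_piX; apply/quotient_eqP; rewrite mulg1; apply/mem_set/subV/NH.
have -> : completion_comp (u ^+ (p ^ j)) N = completion_comp u N ^+ (p ^ j).
  elim: (p ^ j)%N => [|n IH]; first by rewrite !expg0.
  by rewrite !expgS -IH.
rewrite -[completion_comp u N]reprK -quotient_piX; apply/quotient_eqP.
by rewrite mulg1; apply/mem_set/subV.
Qed.

End Completion.

(** * The derived subgroup *)

Lemma val_subX (G : groupType) (H : subgroup G) (u : subgroup_type H) n :
  val (u ^+ n) = val u ^+ n.
Proof. exact: gmulfXn. Qed.

Section DerivedSubgroup.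
Variables (p : nat) (lambda : 'F_p).
Hypotheses (p_pr : prime p) (p_odd : odd p).
Hypotheses (lambda_neq1 : lambda != 1%R) (lambda_neq2 : lambda != 2%:R%R).

Local Notation a := (ggs_a p).
Local Notation b := (ggs_b (ggs_vector lambda)).
Local Notation G := (ggs_group (ggs_vector lambda)).
Local Notation G' := (comm_subgroup G G).
Local Notation Gamma := (subgroup_type (derived_subgroup (subgroup_type G))).

(** [Gamma] is a subtype of a subtype; this composite embeds it in Aut T with image G'. *)
Definition dval (u : Gamma) : tree_aut p := val (val u).

Lemma dval_inj : injective dval.
Proof. by move=> u v /val_inj/val_inj. Qed.

Lemma dvalF : {morph dval : u v / u / v}.
Proof. by move=> u v; rewrite /dval !gmulfF. Qed.

HB.instance Definition _ := isGroupMorphism.Build Gamma (tree_aut p) dval dvalF.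

Lemma dvalX u n : dval (u ^+ n) = dval u ^+ n.
Proof. exact: gmulfXn. Qed.

Lemma dvalP u : dval u \insub G'.
Proof. exact: (derived_subgroup_val (val u)).1 (valP_sub u). Qed.

Lemma dval_onto x : x \insub G' -> exists u, dval u = x.
Proof.
move=> Gx; have [v vx] := sub_val (derived_sub Gx).
have [|u uv] := @sub_val _ (derived_subgroup (subgroup_type G)) v.
  by apply/derived_subgroup_val; rewrite vx.
by exists u; rewrite /dval uv.
Qed.

Lemma ggs_derived_torsion_free : torsion_free Gamma.
Proof.
move=> x n n0 xn; apply: dval_inj; rewrite gmulf1.
apply: (gclass0_torsion_free p_pr lambda_neq2 _ n0).
  by apply: gclass_derived => //; apply: dvalP.
by rewrite -dvalX xn gmulf1.
Qed.

(** If a and b commuted, comparing the sections of b^a and b at the last letter would give a = b;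
    but a moves letters and b does not. *)
Lemma commg_ab_neq1 : [~ a, b] != 1.
Proof.
apply/eqP => ab1; pose x := letter_of p_pr (-1)%R.
have aE : b ^ a = b by apply/conjg_fixP; rewrite commg1_sym ab1.
have : section (b ^ a) [:: x] = section b [:: x] by rewrite aE.
rewrite -{1}(apow1 p_pr) section_conj_apow //.
rewrite !section_b // letter_apow // /x letter_ofK addNr add0r b_section0 b_section1 //.
move=> /(congr1 (fun g => phi (letter g x))).
rewrite letter_b letter_a phi_ordS // => /eqP.
by rewrite /x letter_ofK addNr eq_sym oppr_eq0 oner_eq0.
Qed.

Lemma ggs_derived_neq1 : exists u : Gamma, u <> 1.
Proof.
have [u uE] := dval_onto (comm_mem (@a_in_G p lambda) (@b_in_G p lambda)).
by exists u => u1; case/eqP: commg_ab_neq1; rewrite -uE u1 gmulf1.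
Qed.

Lemma ggs_derived_infinite : infinite_group Gamma.
Proof.
move=> /finite_group_exponent [k k0 kE]; have [u] := ggs_derived_neq1.
by apply; apply: (ggs_derived_torsion_free k0 (kE u)).
Qed.

Lemma ggs_derived_finitely_generated : finitely_generated Gamma.
Proof.
have [a' a'E] := sub_val (@a_in_G p lambda); have [b' b'E] := sub_val (@b_in_G p lambda).
have genT : generated [set a'; b'] = [set: subgroup_type G] :> set _.
  rewrite -(@gen_subgroup_type _ G [set a; b] erefl); congr (subgroup_set (generated _)).
  apply/seteqP; split=> [_ [->|->]|x [xE|xE]].
  - by left.
  - by right.
  - by left; apply: val_inj; apply: etrans xE (esym a'E).
  - by right; apply: val_inj; apply: etrans xE (esym b'E).
have p0 := prime_gt0 p_pr.
have a'p : a' ^+ p = 1.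
  by apply: val_inj; rewrite val_subX a'E gmulf1 expg_a_p.
have b'p : b' ^+ p = 1.
  by apply: val_inj; rewrite val_subX b'E gmulf1 expg_b_p.
have := derived_generators p0 a'p b'p; set S := [set z | _] => defS.
exists (val @^-1` S).
  apply: finite_preimage; first by move=> x y _ _; apply: val_inj.
  apply: (@sub_finite_set _ _ ((fun ij => [~ a' ^+ ij.1, b' ^+ ij.2]) @`
      (`I_p `*` `I_p))); last by apply/finite_image/finite_setX; apply: finite_II.
  by move=> _ [i [j [ip jp ->]]]; exists (i, j).
apply: gen_subgroup_type; rewrite -defS.
have GT x : x \insub generated [set a'; b'] by rewrite genT.
apply/seteqP; split=> x; apply: gen_min.
  by move=> _ [y [z [_ _ ->]]]; apply: gen_mem; exists y, z.
by move=> _ [y [z ->]]; apply: comm_mem.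
Qed.

Lemma level_tuple (g : tree_aut p) n (t : n.-tuple 'I_p) : size (g t) == n.
Proof. by rewrite tree_aut_size size_tuple. Qed.

Lemma ggs_derived_level_kernel n : exists N : finite_quotient_kernel Gamma,
  forall x, x \insub N <-> forall v, size v = n -> dval x v = v.
Proof.
pose S := [set x : Gamma | forall v, size v = n -> dval x v = v].
have S1 : S 1 by move=> v _; rewrite gmulf1.
have SF x y : S x -> S y -> S (x / y).
  move=> Sx Sy v vn; rewrite gmulfF mulE (fixV (Sy v vn)).
  exact: Sx.
pose H := Subgroup (group_closedP S1 SF).
have HJ x y : (H : set Gamma) x -> (H : set Gamma) (x ^ y).
  move=> Sx v vn; rewrite gmulfJ /conjg !mulE Sx ?tree_aut_size //.
  by rewrite -mulE mulVg oneE.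
have Hfin : finite_index (NormalSubgroup HJ).
  apply: (@finite_index_inj _ _ {ffun n.-tuple 'I_p -> n.-tuple 'I_p}
    (fun x => [ffun t => Tuple (level_tuple (dval x) t)]) setT) => //.
  move=> x y /ffunP xy v /eqP vn; rewrite gmulfM gmulfV mulE.
  have := xy (Tuple vn); rewrite !ffunE => /(congr1 val) E.
  have {}E : dval x v = dval y v by [].
  by rewrite -E -mulE mulVg oneE.
by exists (FiniteQuotientKernel Hfin).
Qed.

Lemma ggs_derived_residually_finite : residually_finite Gamma.
Proof.
move=> x x1; have [w xw] : exists w, dval x w != w.
  apply: contrapT => /forallNP E; case/eqP: x1; apply: dval_inj; rewrite gmulf1.
  by apply: tree_aut_ext => w; apply: contrapT => /eqP/E.
have [N NE] := ggs_derived_level_kernel (size w).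
by exists N => /NE /(_ w erefl) /eqP; rewrite (negPf xw).
Qed.

(** If k is an exponent of the quotient, [N] contains all k-th powers, hence all G-conjugates of a
    nontrivial c^k. The subgroup [K] of elements with this conjugation property is normalized by G,
    and [normal_exponent] applies to it. *)
Lemma ggs_derived_exponent (N : finite_quotient_kernel Gamma) (x : Gamma) :
  exists j, x ^+ (p ^ j) \insub N.
Proof.
have [k k0 kN] := finite_group_exponent (fqk_finite N : finite_set [set: quotient N]).
have {}kN u : u ^+ k \insub N.
  have := kN (\pi_(quotient N) u); rewrite -quotient_piX => /quotient_eqP.
  by rewrite mulg1 => /set_mem; apply: subVE.
(* [N] is normal in G' but perhaps not in G; this is the set of elements all of whose G-conjugates
   come from [N]. *)
pose P := [set g | forall h, h \insub G -> exists2 u, u \insub N & dval u = g ^ h].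
have P1 : P 1.
  by move=> h _; exists 1; [exact: sub1 | rewrite gmulf1 conj1g].
have PF g g' : P g -> P g' -> P (g / g').
  move=> Pg Pg' h Gh; have [u Nu uE] := Pg h Gh; have [v Nv vE] := Pg' h Gh.
  by exists (u / v); [exact: subF | rewrite dvalF uE vE conjMg conjVg].
pose K := Subgroup (group_closedP P1 PF).
have KG g : g \insub G -> normalizes K g.
  move=> Gg y Ky h Gh; rewrite -conjgM; apply: Ky; exact: subM.
have [c c1] := ggs_derived_neq1.
have Kc : dval c ^+ k \insub K.
  move=> h Gh; have [u uE] := dval_onto (derived_normal Gh (dvalP c)).
  by exists (u ^+ k); [apply: kN | rewrite dvalX uE conjXg].
(* Torsion-freeness of G' is what keeps c^k nontrivial. *)
have ck : dval c ^+ k != 1.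
  have d1 : dval 1 = 1 by apply: gmulf1.
  rewrite -dvalX -d1; apply/eqP => /dval_inj ck.
  exact: c1 (ggs_derived_torsion_free k0 ck).
have [n nK] := normal_exponent p_pr p_odd lambda_neq1 lambda_neq2 KG Kc ck.
exists n; have [u Nu] := nK _ (derived_sub (dvalP x)) 1 (sub1 _).
by rewrite conjg1 -dvalX => /dval_inj <-.
Qed.

End DerivedSubgroup.

Local Open Scope ring_scope.

Theorem theoremD (p : nat) (lambda : 'F_p) :
  prime p -> odd p -> lambda != 1 -> lambda != 2%:R ->
  let e : 'rV['F_p]_(p.-1) :=
    \row_(i < p.-1) (if i.+1 == p.-1 then lambda else 1) in
  let G : groupType := subgroup_type (ggs_group e) in
  let G' : groupType := subgroup_type (derived_subgroup G) in
  [/\ infinite_group G', finitely_generated G', residually_finite G',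
      torsion_free G' & pro_p_group p (profinite_completion G')].
Proof.
move=> p_pr p_odd l1 l2 e G G'; split.
- exact: ggs_derived_infinite.
- exact: ggs_derived_finitely_generated.
- exact: ggs_derived_residually_finite.
- exact: ggs_derived_torsion_free.
- by apply: completion_pro_p => // N x; apply: ggs_derived_exponent.
Qed.
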